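(* Let $L$ be a nilpotent Lie superalgebra with $\dim L=(m\mid n)$. Then $s(L)=0$ if and only if $L$ is isomorphic to one of $$H(1,0)\oplus A(m-3\mid n),\qquad A(2\mid 0),\qquad A(0\mid 2),\qquad A(1\mid 1).$$
   Context: All Lie superalgebras are finite dimensional over $\mathbb{C}$. $\dim L=(m\mid n)$ means $\dim L_{\bar 0}=m$, $\dim L_{\bar 1}=n$. Isomorphisms are bijective even (degree-preserving) homomorphisms. $L$ is nilpotent if its descending central sequence $L^0=L$, $L^{k+1}=[L^k,L]$ reaches $0$. Schur multiplier: for a free presentation $0\to R\to F\to L\to 0$ with $F$ a free Lie superalgebra, $\mathcal M(L)=\frac{[F,F]\cap R}{[F,R]}$ (independent of the presentation up to isomorphism); $\dim\mathcal M(L)$ is its total dimension (even plus odd). For $\dim L=(m\mid n)$ define $s(L)=\frac12(m+n-2)(m+n-1)+n+1-\dim\mathcal M(L)$. $A(k\mid l)$ ($k,l\ge 0$) denotes the abelian Lie superalgebra (all brackets zero) of dimension $(k\mid l)$; an entry involving $A(k\mid l)$ occurs only when $k,l\ge 0$. $H(p,q)$ ($p,q\ge0$, $p+q\ge1$) is the special Heisenberg Lie superalgebra with even center, of dimension $(2p+1\mid q)$: even basis $x_1,\dots,x_{2p},z$, odd basis $y_1,\dots,y_q$, nonzero brackets (up to graded skew-symmetry) $[x_i,x_{p+i}]=z$ for $1\le i\le p$ and $[y_j,y_j]=z$ for $1\le j\le q$. *)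

(* Defs.v *)
From HB Require Import structures.
From mathcomp Require Import all_boot all_order all_algebra.
From mathcomp Require Import boolp classical_sets.

Set Implicit Arguments.
Unset Strict Implicit.
Unset Printing Implicit Defensive.

Import Order.TTheory GRing.Theory Num.Theory.
Local Open Scope classical_set_scope.
Local Open Scope ring_scope.

Section Subspaces.
Variables (K : numFieldType) (V : lmodType K).

Definition subspace (A : set V) : Prop :=
  A 0 /\ forall (a : K) (x y : V), A x -> A y -> A (a *: x + y).

Definition span (G : set V) : set V := smallest subspace G.

(* For subspaces B `<=` A: the quotient A / B has dimension d, i.e. some
   e_1, ..., e_d in A induce a basis of A / B. *)
Definition quotient_dim (A B : set V) (d : nat) : Prop :=
  exists e : 'I_d -> V,
    [/\ forall i, A (e i),
        forall c : 'I_d -> K, B (\sum_i c i *: e i) -> forall i, c i = 0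
      & forall x, A x -> exists c : 'I_d -> K, B (x - \sum_i c i *: e i)].

Definition subspace_dim (A : set V) (d : nat) : Prop :=
  quotient_dim A [set 0] d.

End Subspaces.

(* Superspaces are Z/2-graded: the degree is a boolean, false for even and
   true for odd; degrees add up by (+), and i && j is the product of i and j.
   No finiteness is required here, since free Lie superalgebras are in general
   infinite dimensional. *)
Record is_lie_superalgebra (K : numFieldType) (V : lmodType K)
    (part : bool -> set V) (br : V -> V -> V) : Prop := IsLieSuperalgebra {
  part_subspace : forall i, subspace (part i);
  part_sum : forall x, exists x0 x1,
    [/\ part false x0, part true x1 & x = x0 + x1];
  part_direct : forall x, part false x -> part true x -> x = 0;
  br_linearl : forall y, linear (fun x => br x y);
  br_linearr : forall x, linear (br x);
  br_graded : forall i j x y,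
    part i x -> part j y -> part (i (+) j) (br x y);
  br_skew : forall i j x y, part i x -> part j y ->
    br x y = - ((-1) ^+ (i && j) *: br y x);
  br_jacobi : forall i j x y z, part i x -> part j y ->
    br x (br y z) = br (br x y) z + (-1) ^+ (i && j) *: br y (br x z)
}.

Record lieSuperalgebra (K : numFieldType) := LieSuperalgebra {
  lsa_carrier :> lmodType K;
  lsa_part : bool -> set lsa_carrier;
  lsa_br : lsa_carrier -> lsa_carrier -> lsa_carrier;
  lsa_axioms : is_lie_superalgebra lsa_part lsa_br
}.

Section LieSuperalgebras.
Variable K : numFieldType.
Implicit Types L M : lieSuperalgebra K.

(* [A, B] is the linear span of the brackets of elements of A and B. *)
Definition br_span L (A B : set L) : set L :=
  span [set lsa_br x y | x in A & y in B].

Definition descending_central L (k : nat) : set L :=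
  iter k (fun A => br_span A setT) setT.

Definition nilpotent L : Prop :=
  exists k, @descending_central L k = [set 0].

Definition superdim L (m n : nat) : Prop :=
  subspace_dim (@lsa_part K L false) m /\ subspace_dim (@lsa_part K L true) n.

(* Homomorphisms are even. *)
Definition lie_hom L M (f : {linear L -> M}) : Prop :=
  (forall i x, lsa_part i x -> lsa_part i (f x)) /\
  (forall x y, f (lsa_br x y) = lsa_br (f x) (f y)).

Definition isomorphic L M : Prop :=
  exists f : {linear L -> M}, lie_hom f /\ bijective f.

(* F is free on the graded set (X, deg), through the map inc. *)
Definition free_on (X : Type) (deg : X -> bool) (F : lieSuperalgebra K)
    (inc : X -> F) : Prop :=
  (forall x, lsa_part (deg x) (inc x)) /\
  forall (M : lieSuperalgebra K) (f : X -> M),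
    (forall x, lsa_part (deg x) (f x)) ->
    (exists g : {linear F -> M}, lie_hom g /\ forall x, g (inc x) = f x) /\
    (forall g h : {linear F -> M}, lie_hom g -> lie_hom h ->
       (forall x, g (inc x) = f x) -> (forall x, h (inc x) = f x) ->
       forall u, g u = h u).

Record free_presentation L := FreePresentation {
  fp_gen : Type;
  fp_deg : fp_gen -> bool;
  fp_alg : lieSuperalgebra K;
  fp_inc : fp_gen -> fp_alg;
  fp_free : free_on fp_deg fp_inc;
  fp_map : {linear fp_alg -> L};
  fp_hom : lie_hom fp_map;
  fp_surj : forall y, exists x, fp_map x = y
}.

Definition fp_rel L (P : free_presentation L) : set (fp_alg P) :=
  [set x | fp_map P x = 0].

(* The Schur multiplier (`[F, F] `&` R) / [F, R] computed from P has total
   dimension d. *)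
Definition multiplier_dim_of L (P : free_presentation L) (d : nat) : Prop :=
  quotient_dim (br_span setT setT `&` @fp_rel L P) (br_span setT (@fp_rel L P)) d.

(* The dimension does not depend on the presentation; the default value 0 is
   only used when the multiplier is infinite dimensional, which does not happen
   for finite dimensional L. *)
Definition multiplier_dim L : nat :=
  xget 0%N [set d | exists P : free_presentation L, multiplier_dim_of P d].

(* s(L), for L of dimension (m | n). *)
Definition s_invariant L (m n : nat) : rat :=
  (m%:R + n%:R - 2) * (m%:R + n%:R - 1) / 2 + n%:R + 1
  - (multiplier_dim L)%:R.

End LieSuperalgebras.

Arguments descending_central {K} L k _.
Arguments fp_rel {K L} P _.

Section Abelian.
Variables (K : numFieldType) (k l : nat).

Definition abelian_carrier : lmodType K := ('rV[K]_k * 'rV[K]_l)%type.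

Definition abelian_part (i : bool) : set abelian_carrier :=
  if i then [set x | x.1 = 0] else [set x | x.2 = 0].

Definition abelian_br (x y : abelian_carrier) : abelian_carrier := 0.

Lemma abelian_axioms : is_lie_superalgebra abelian_part abelian_br.
Proof.
split; rewrite /abelian_br.
- by case; split=> //= a x y /= -> ->; rewrite scaler0 addr0.
- move=> [u v]; exists (u, 0), (0, v); split=> //=.
  by congr pair; rewrite /= ?addr0 ?add0r.
- by move=> [u v] /= -> ->.
- by move=> y a u v; rewrite scaler0 addr0.
- by move=> y a u v; rewrite scaler0 addr0.
- by case; case.
- by move=> i j x y _ _; rewrite scaler0 oppr0.
- by move=> i j x y z _ _; rewrite scaler0 addr0.
Qed.

Definition abelian : lieSuperalgebra K := LieSuperalgebra abelian_axioms.

End Abelian.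

(* An element (a, a', t, c) stands for
   \sum_i (a_i x_i + a'_i x_(p+i)) + t z + \sum_j c_j y_j. *)
Section Heisenberg.
Variables (K : numFieldType) (p q : nat).

Definition heisenberg_carrier : lmodType K :=
  ('rV[K]_p * 'rV[K]_p * K^o * 'rV[K]_q)%type.

Definition heisenberg_part (i : bool) : set heisenberg_carrier :=
  if i then [set x | x.1 = 0] else [set x | x.2 = 0].

Definition heisenberg_form (x y : heisenberg_carrier) : K^o :=
  \sum_(i < p) (x.1.1.1 0 i * y.1.1.2 0 i - x.1.1.2 0 i * y.1.1.1 0 i)
  + \sum_(j < q) x.2 0 j * y.2 0 j.

Definition heisenberg_br (x y : heisenberg_carrier) : heisenberg_carrier :=
  (0, 0, heisenberg_form x y, 0).

Lemma heisenberg_form_linearl y : linear (fun x => heisenberg_form x y).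
Proof.
move=> a u v; rewrite /heisenberg_form scalerDr !scaler_sumr addrACA.
rewrite -!big_split /=; congr (_ + _); apply: eq_bigr => i _; rewrite !mxE.
  by rewrite -[a *: _]/(a * _) !mulrDl mulrBr !mulrA opprD addrACA.
by rewrite -[a *: _]/(a * _) mulrDl mulrA.
Qed.

Lemma heisenberg_form_skew (i j : bool) x y :
  heisenberg_part i x -> heisenberg_part j y ->
  heisenberg_form x y = - ((-1) ^+ (i && j) *: heisenberg_form y x).
Proof.
rewrite /heisenberg_form -[_ *: _]/(_ * _).
have even_skew : \sum_(i < p)
    (x.1.1.1 0 i * y.1.1.2 0 i - x.1.1.2 0 i * y.1.1.1 0 i) =
  - \sum_(i < p) (y.1.1.1 0 i * x.1.1.2 0 i - y.1.1.2 0 i * x.1.1.1 0 i).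
  rewrite -sumrN; apply: eq_bigr => h _.
  by rewrite opprB mulrC [X in _ - X]mulrC.
have odd_sym : \sum_(j < q) x.2 0 j * y.2 0 j = \sum_(j < q) y.2 0 j * x.2 0 j.
  by apply: eq_bigr => h _; rewrite mulrC.
have odd0 (u v : 'rV[K]_q) : u = 0 -> \sum_(j < q) u 0 j * v 0 j = 0.
  by move=> ->; rewrite big1 // => h _; rewrite mxE mul0r.
have even0 (u v : 'rV[K]_p * 'rV[K]_p * K^o) : u = 0 ->
    \sum_(i < p) (u.1.1 0 i * v.1.2 0 i - u.1.2 0 i * v.1.1 0 i) = 0.
  by move=> ->; rewrite big1 // => h _; rewrite !mxE !mul0r subr0.
case: i; case: j => /= hx hy.
- by rewrite !even0 // !add0r mulN1r opprK.
- by rewrite mul1r even_skew odd_sym !(odd0 _ _ hy) !addr0.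
- by rewrite mul1r even_skew -odd_sym !(odd0 _ _ hx) !addr0.
- by rewrite mul1r even_skew odd_sym !(odd0 _ _ hy) !addr0.
Qed.

Lemma heisenberg_axioms : is_lie_superalgebra heisenberg_part heisenberg_br.
Proof.
have form_l := heisenberg_form_linearl.
have form_center x t : heisenberg_form x (0, 0, t, 0) = 0.
  rewrite /heisenberg_form !big1 ?addr0 // => h _ /=; rewrite !mxE !mulr0 //.
  by rewrite subr0.
have center_form x t : heisenberg_form (0, 0, t, 0) x = 0.
  rewrite /heisenberg_form !big1 ?addr0 // => h _ /=; rewrite !mxE !mul0r //.
  by rewrite subr0.
have form_r x : linear (heisenberg_form x).
  move=> a u v; rewrite /heisenberg_form scalerDr !scaler_sumr addrACA.
  rewrite -!big_split /=; congr (_ + _); apply: eq_bigr => i _; rewrite !mxE.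
    by rewrite -[a *: _]/(a * _) !mulrDr mulrN !(mulrCA _ a) opprD addrACA.
  by rewrite -[a *: _]/(a * _) mulrDr mulrCA.
split; rewrite /heisenberg_br.
- by case; split=> //= a x y /= -> ->; rewrite scaler0 addr0.
- move=> [u v]; exists (u, 0), (0, v); split=> //=.
  by congr pair; rewrite /= ?addr0 ?add0r.
- by move=> [u v] /= -> ->.
- by move=> y a u v; rewrite form_l; congr (_, _, _, _);
     rewrite /= scaler0 addr0.
- by move=> y a u v; rewrite form_r; congr (_, _, _, _);
     rewrite /= scaler0 addr0.
- case; case=> x y //= hx hy; congr (_, _, _); rewrite /heisenberg_form.
    rewrite hx hy big1 => [|h _]; last by rewrite !mxE !mul0r subr0.
    by rewrite add0r big1 // => h _; rewrite mxE mulr0.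
  rewrite hy hx big1 => [|h _]; last by rewrite !mxE !mulr0 subr0.
  by rewrite add0r big1 // => h _; rewrite mxE mul0r.
- move=> i j x y hx hy; rewrite (heisenberg_form_skew hx hy).
  by congr (_, _, _, _); rewrite /= scaler0 oppr0.
- move=> i j x y z _ _; rewrite !form_center center_form.
  by congr (_, _, _, _); rewrite /= scaler0 addr0.
Qed.

Definition heisenberg : lieSuperalgebra K := LieSuperalgebra heisenberg_axioms.

End Heisenberg.

Section DirectSum.
Variables (K : numFieldType) (L M : lieSuperalgebra K).

Definition dsum_carrier : lmodType K := (L * M)%type.

Definition dsum_part (i : bool) : set dsum_carrier :=
  [set x | lsa_part i x.1 /\ lsa_part i x.2].

Definition dsum_br (x y : dsum_carrier) : dsum_carrier :=
  (lsa_br x.1 y.1, lsa_br x.2 y.2).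

Lemma dsum_axioms : is_lie_superalgebra dsum_part dsum_br.
Proof.
have [sL dL zL lL rL gL kL jL] := lsa_axioms L.
have [sM dM zM lM rM gM kM jM] := lsa_axioms M.
split.
- move=> i; split; first by split; [case: (sL i)|case: (sM i)].
  move=> a x y [x1 x2] [y1 y2].
  by split; [apply: (sL i).2|apply: (sM i).2].
- move=> [u v]; have [u0 [u1 [hu0 hu1 ->]]] := dL u.
  have [v0 [v1 [hv0 hv1 ->]]] := dM v.
  by exists (u0, v0), (u1, v1).
- by move=> [u v] [/= u0 v0] [/= u1 v1]; rewrite (zL u) // (zM v).
- by move=> y a u v; congr pair; rewrite /= ?lL ?lM.
- by move=> y a u v; congr pair; rewrite /= ?rL ?rM.
- by move=> i j x y [x1 x2] [y1 y2]; split; [apply: gL|apply: gM].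
- move=> i j x y [x1 x2] [y1 y2]; congr pair => /=.
    exact: kL x1 y1.
  exact: kM x2 y2.
- move=> i j x y z [x1 x2] [y1 y2]; congr pair => /=.
    exact: jL x1 y1.
  exact: jM x2 y2.
Qed.

Definition dsum : lieSuperalgebra K := LieSuperalgebra dsum_axioms.

End DirectSum.

(* Main.v *)
(* Let N = m + n and let F / R be a free presentation of L. Then s(L) = 0 amounts
   to dim M(L) + N = binom(N, 2) + n + 2.

   Since M(L) has dimension dim [F, F]/[F, R] - dim [L, L], upper bounds come
   from spanning sets of [F, F]/[F, R], which is generated by the brackets of
   lifts of pairs of vectors of a homogeneous basis of L: the binom(N, 2) pairs
   of distinct vectors and the n odd vectors paired with themselves. The Jacobi
   identity makes some of these pairs redundant. If L is nilpotent and not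
   abelian, at least dim L/[L, L] - 1 of them are, hence
   dim M(L) + N <= binom(N, 2) + n + 1, except when [L, L] is an even central
   line spanned by z = [x, y] and the centralizer of x and y is abelian; this
   exceptional case is that of H(1,0) + A(m-3|n).

   Lower bounds come from one-dimensional central extensions of L by cocycles
   supported on a single pair of basis vectors: F lifts to such an extension
   and [F, R] dies there, so the brackets of lifts of the remaining pairs are
   independent modulo [F, R]. This gives dim M(L) = binom(N, 2) + n if L is
   abelian, whence N = 2, and s(L) = 0 for H(1,0) + A(m-3|n). *)

(* The exterior square of [L] is never built. Dimension counts are Steinitz exchanges modulo a
   subspace, and a redundancy is a statement about every [jacobi_closed] relation [th]: once it
   contains the kept pairs, it contains the removed ones. The kept pairs decide how much is gained.
   Rewriting g /\ [x, w] by Jacobi gives [g, x] /\ w and x /\ [g, w], so pairs of x and w with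
   [L, L] that must not have been removed themselves. Hence some generators stay aside: one, if x
   and w are multiples of it modulo [L, L], and two, if x and w are independent there. Keeping one
   aside is affordable; keeping two leaves the count short by one, and H(1,0) + A(m-3|n) lives on
   that missing unit. Nilpotency supplies a generator outside [L, L]; that [L, L] is central is then
   extracted from the failure of the bound. [multiplier_dim] takes its value from some presentation:
   the bounds are therefore proved for an arbitrary one, and a free Lie superalgebra is constructed
   to know that the value is not the default. *)
From HB Require Import structures.
Require Import Defs.
From mathcomp Require Import all_boot all_order all_algebra.
From mathcomp Require Import generic_quotient boolp classical_sets.
From mathcomp Require Import reals complex ring zify.

Set Implicit Arguments.
Unset Strict Implicit.
Unset Printing Implicit Defensive.

Import Order.TTheory GRing.Theory Num.Theory.
Local Open Scope classical_set_scope.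
Local Open Scope ring_scope.

(** * Independent families modulo a subspace *)

Section Families.
Variables (K : numFieldType) (V : lmodType K).
Implicit Types (A B T G : set V) (u v : V).

Lemma subspace0 A : subspace A -> A 0. Proof. by case. Qed.

Lemma subspaceZ A a u : subspace A -> A u -> A (a *: u).
Proof. by case=> A0 AL Au; rewrite -[a *: u]addr0; apply: AL. Qed.

Lemma subspaceD A u v : subspace A -> A u -> A v -> A (u + v).
Proof. by case=> A0 AL Au Av; rewrite -[u]scale1r; apply: AL. Qed.

Lemma subspaceN A u : subspace A -> A u -> A (- u).
Proof. by move=> sA Au; rewrite -scaleN1r; apply: subspaceZ. Qed.

Lemma subspaceB A u v : subspace A -> A u -> A v -> A (u - v).
Proof. by move=> sA Au Av; apply: subspaceD => //; apply: subspaceN. Qed.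

Lemma subspaceDl A u v : subspace A -> A u -> A (u + v) -> A v.
Proof. by move=> sA Au Auv; rewrite -[v](addKr u) addrC; apply: subspaceB. Qed.

Lemma subspaceZK A a u : subspace A -> a != 0 -> A (a *: u) -> A u.
Proof.
move=> sA a0 Au; rewrite -[u]scale1r -(mulVf a0) -scalerA.
exact: subspaceZ.
Qed.

Lemma subspace_sum A (I : Type) (r : seq I) (P : pred I) (F : I -> V) :
  subspace A -> (forall i, P i -> A (F i)) -> A (\sum_(i <- r | P i) F i).
Proof.
move=> sA AF; apply: big_ind => //; first exact: subspace0.
by move=> u v; apply: subspaceD.
Qed.

Lemma subspace_set0 : subspace [set 0 : V].
Proof. by split=> // a u v /= -> ->; rewrite scaler0 addr0. Qed.

Lemma span_subspace G : subspace (Defs.span G).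
Proof.
split=> [A [sA _]|a u v Gu Gv A AG]; first exact: subspace0.
by case: (AG) => -[_ AL] _; apply: AL; [apply: Gu|apply: Gv].
Qed.

Lemma mem_span G u : G u -> Defs.span G u.
Proof. by move=> Gu A [_]; apply. Qed.

Lemma span_min G A : subspace A -> G `<=` A -> Defs.span G `<=` A.
Proof. by move=> sA GA u; apply. Qed.

(** Working modulo [B] lets one notion serve [L], L/[L, L] and F/[F, R] without forming quotient
    spaces. *)
Definition indep B (I : finType) (e : I -> V) : Prop :=
  forall c : I -> K, B (\sum_i c i *: e i) -> forall i, c i = 0.

Definition spanned B (I : finType) (e : I -> V) : set V :=
  [set v | exists c : I -> K, B (v - \sum_i c i *: e i)].

Lemma spanned_subspace B (I : finType) (e : I -> V) :
  subspace B -> subspace (spanned B e).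
Proof.
move=> sB; split=> [|a u v [c Bu] [c' Bv]].
  exists (fun=> 0); rewrite big1 ?subr0; first exact: subspace0.
  by move=> i _; rewrite scale0r.
exists (fun i => a * c i + c' i).
under eq_bigr do rewrite scalerDl -scalerA.
rewrite big_split -scaler_sumr opprD addrACA -scalerBr.
by apply: sB.2.
Qed.

Lemma spanned_mem B (I : finType) (e : I -> V) i :
  subspace B -> spanned B e (e i).
Proof.
move=> sB; exists (fun j => (j == i)%:R).
rewrite (bigD1 i) //= eqxx scale1r big1 ?addr0 ?subrr; first exact: subspace0.
by move=> j /negPf ->; rewrite scale0r.
Qed.

Lemma sub_spanned B (I : finType) (e : I -> V) : B `<=` spanned B e.
Proof.
move=> u Bu; exists (fun=> 0); rewrite big1 ?subr0 //.
by move=> i _; rewrite scale0r.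
Qed.

Lemma spanned_min B (I : finType) (e : I -> V) T : subspace T ->
  B `<=` T -> (forall i, T (e i)) -> spanned B e `<=` T.
Proof.
move=> sT BT Te u [c /BT Tu]; rewrite -[u](subrK (\sum_i c i *: e i)).
apply: subspaceD => //; apply: subspace_sum => // i _; exact: subspaceZ.
Qed.

Lemma spannedW B B' (I : finType) (e : I -> V) :
  B `<=` B' -> spanned B e `<=` spanned B' e.
Proof. by move=> BB' u [c /BB' Bu]; exists c. Qed.

Lemma indep_inj B (I J : finType) (h : J -> I) (e : I -> V) :
  injective h -> indep B e -> indep B (e \o h).
Proof.
move=> hI ie c Bc j.
pose c' i := \sum_(k | h k == i) c k.
have c'h k : c' (h k) = c k.
  rewrite /c' (bigD1 k) //= big1 ?addr0 // => l /andP[/eqP/hI ->].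
  by rewrite eqxx.
rewrite -c'h; apply: ie.
suff -> : \sum_i c' i *: e i = \sum_i c i *: (e \o h) i by [].
under eq_bigr do rewrite scaler_suml.
rewrite (exchange_big_dep predT) //=; apply: eq_bigr => k _.
rewrite (big_pred1 (h k)) // => i; exact: eq_sym.
Qed.

(** A coefficient matrix with more rows than columns has a nonzero vector in its left kernel; the
    corresponding combination of [e] loses its [s]-part and falls into [B]. *)
Lemma steinitz B (I J : finType) (e : I -> V) (s : J -> V) :
  subspace B -> indep B e -> (forall i, spanned B s (e i)) -> (#|I| <= #|J|)%N.
Proof.
move=> sB ie /choice[c Bc]; rewrite leqNgt; apply/negP => ltJI.
pose A : 'M[K]_(#|I|, #|J|) := \matrix_(i, j) c (enum_val i) (enum_val j).
have : kermx A != 0.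
  rewrite kermx_eq0 /row_free; apply/eqP => rA.
  by have := rank_leq_col A; rewrite rA leqNgt ltJI.
case/rowV0Pn => u /sub_kermxP uA /negP; apply; apply/eqP/rowP => i0.
rewrite mxE -[i0]enum_valK.
apply: (ie (fun i => u 0 (enum_rank i))).
have -> : \sum_i u 0 (enum_rank i) *: e i =
  \sum_i u 0 (enum_rank i) *: (e i - \sum_j c i j *: s j).
  under [RHS]eq_bigr do rewrite scalerBr.
  rewrite big_split /= sumrN; under [X in _ - X]eq_bigr do rewrite scaler_sumr.
  rewrite [X in _ - X]exchange_big [X in _ - X]big1 ?subr0 //= => j _.
  under eq_bigr do rewrite scalerA.
  rewrite -scaler_suml.
  have := congr1 (fun M : 'rV_ _ => M 0 (enum_rank j)) uA; rewrite !mxE => uAj.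
  rewrite [X in X *: _](_ : _ = 0) ?scale0r // -[RHS]uAj.
  rewrite (reindex (fun k : 'I_#|I| => enum_val k)) /=; last first.
    by apply: onW_bij; apply: enum_val_bij.
  by apply: eq_bigr => k _; rewrite mxE enum_valK enum_rankK.
by apply: subspace_sum => // i _; apply: subspaceZ.
Qed.

Definition famcat (I J : Type) (T : Type) (e : I -> T) (f : J -> T)
  (k : I + J) : T := match k with inl i => e i | inr j => f j end.

Lemma sum_famcat (I J : finType) (e : I -> V) (f : J -> V) (c : I + J -> K) :
  \sum_k c k *: famcat e f k =
  \sum_i c (inl i) *: e i + \sum_j c (inr j) *: f j.
Proof. by rewrite big_sumType. Qed.

(** Modulo [A] a relation only sees [e], whose coefficients vanish first; what remains is a relation
    on [f] modulo [B]. *)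
Lemma indep_famcat B A (I J : finType) (e : I -> V) (f : J -> V) :
  subspace A -> B `<=` A -> (forall j, A (f j)) -> indep A e -> indep B f ->
  indep B (famcat e f).
Proof.
move=> sA BA Af ie jf c Bc.
have c0 i : c (inl i) = 0.
  apply: (ie (fun i => c (inl i))).
  move: Bc; rewrite sum_famcat addrC => /BA; apply: subspaceDl => //.
  by apply: subspace_sum => // j _; apply: subspaceZ.
case=> // j; apply: (jf (fun j => c (inr j))).
move: Bc; rewrite sum_famcat big1 ?add0r // => i _.
by rewrite c0 scale0r.
Qed.

Lemma spanned_famcat B A (I J : finType) (e : I -> V) (f : J -> V) :
  subspace B -> B `<=` A -> A `<=` spanned B f ->
  spanned A e `<=` spanned B (famcat e f).
Proof.
move=> sB BA Af; have sS := spanned_subspace (famcat e f) sB.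
move=> v [c Av]; rewrite -[v](subrK (\sum_i c i *: e i)).
apply: subspaceD => //.
  have [c' Bc'] := Af _ Av.
  exists (famcat (fun=> 0) c'); rewrite sum_famcat [X in _ - (X + _)]big1 ?add0r //.
  by move=> i _; rewrite scale0r.
apply: subspace_sum => // i _; apply: subspaceZ => //.
exact: (spanned_mem (famcat e f) (inl i)).
Qed.

Lemma indep_extend1 B (I : finType) (k : nat) (e0 : I -> V) (e : 'I_k -> V) v :
  subspace B -> indep B (famcat e0 e) -> ~ spanned B (famcat e0 e) v ->
  exists e' : 'I_k.+1 -> V, (forall i, e' i = v \/ exists j, e' i = e j) /\
    indep B (famcat e0 e').
Proof.
move=> sB ie nv.
exists (fun i => if unlift ord_max i is Some j then e j else v).
have eE i : (if unlift ord_max (widen_ord (leqnSn k) i) is Some j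
             then e j else v) = e i.
  have -> : widen_ord (leqnSn k) i = lift ord_max i.
    by apply/ord_inj; rewrite lift_max.
  by rewrite liftK.
split=> [i|c] /=.
  by case: (unliftP ord_max i) => [j _|_]; [right; exists j|left].
rewrite sum_famcat big_ord_recr /= unlift_none addrA.
under [X in _ + X + _]eq_bigr do rewrite eE.
set S := (X in B (X + _)) => Bc.
pose c' : I + 'I_k -> K :=
  famcat (fun i => c (inl i)) (fun j => c (inr (widen_ord (leqnSn k) j))).
have SE : S = \sum_i c' i *: famcat e0 e i by rewrite sum_famcat.
have cv : c (inr ord_max) = 0.
  apply/eqP/negPn/negP => cn0; apply: nv.
  set a := c (inr ord_max) in cn0 Bc.
  exists (fun i => - (a^-1 * c' i)).
  apply: (subspaceZK sB cn0).
  rewrite scalerBr scaler_sumr.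
  under eq_bigr do rewrite scalerA mulrN mulrA mulfV // mul1r scaleNr.
  by rewrite sumrN opprK addrC -SE.
move: Bc; rewrite cv scale0r addr0 SE => /ie c'0.
case=> i; first exact: (c'0 (inl i)).
case: (unliftP ord_max i) => [j|] ->; last exact: cv.
rewrite (_ : lift _ _ = widen_ord (leqnSn k) j).
  exact: (c'0 (inr j)).
by apply/ord_inj; rewrite lift_max.
Qed.

(** [P] is a mere set, so that the new vectors can be required to be homogeneous. Steinitz against
    [s] bounds their number, and a maximal choice spans. *)
Lemma indep_extend B (P : set V) (I J : finType) (e0 : I -> V) (s : J -> V) :
  subspace B -> indep B e0 ->
  (forall i, spanned B s (e0 i)) -> P `<=` spanned B s ->
  exists k (e : 'I_k -> V), [/\ forall i, P (e i), indep B (famcat e0 e)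
    & P `<=` spanned B (famcat e0 e)].
Proof.
move=> sB ie0 se0 sP.
pose Q k := `[< exists e : 'I_k -> V,
  (forall i, P (e i)) /\ indep B (famcat e0 e) >].
have exQ : exists k, Q k.
  exists 0; apply/asboolP; exists (fun=> 0); split=> [[]//|c].
  rewrite sum_famcat big_ord0 addr0 => /ie0 c0 [] // [] //.
have bQ k : Q k -> (k <= #|J|)%N.
  move/asboolP=> [e [Pe ie]].
  have : (#|{: I + 'I_k}| <= #|J|)%N.
    by apply: (steinitz sB ie) => -[i|i] //=; apply: sP.
  by rewrite card_sum card_ord; apply: leq_trans; apply: leq_addl.
case: (ex_maxnP exQ bQ) => k /asboolP[e [Pe ie]] kmax.
exists k, e; split=> // v Pv; apply: contrapT => nv.
have [e' [e'P ie']] := indep_extend1 sB ie nv.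
have /kmax : Q k.+1.
  by apply/asboolP; exists e'; split=> // i; case: (e'P i) => [->|[j ->]].
by rewrite ltnn.
Qed.

Lemma quotient_dim_exists A B (J : finType) (s : J -> V) :
  subspace B -> A `<=` spanned B s -> exists d, quotient_dim A B d.
Proof.
move=> sB sA.
have [||k [e [Ae ie se]]] := @indep_extend B A 'I_0 J (fun=> 0) s sB _ _ sA.
- by move=> c _ [].
- by case.
exists k, e; split=> //.
  exact: (@indep_inj _ _ _ (@inr 'I_0 'I_k) (famcat (fun=> 0) e) inr_inj ie).
by move=> v /se[c]; rewrite sum_famcat big_ord0 add0r; exists (c \o inr).
Qed.

End Families.

(** * Homogeneous bases *)

Notation br := lsa_br.
Notation part := lsa_part.

Section ParityCount.

Lemma card_famcat (I J : finType) (p : I -> bool) (q : J -> bool) b :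
  (#|[pred k | famcat p q k == b]| =
   #|[pred i | p i == b]| + #|[pred j | q j == b]|)%N.
Proof. by rewrite -!sum1_card big_sumType. Qed.

Lemma card_const (I : finType) (b b' : bool) :
  #|[pred i : I | b == b']| = ((b == b') * #|I|)%N.
Proof.
case: (b == b'); last by rewrite mul0n; apply: eq_card0.
by rewrite mul1n; apply: eq_card.
Qed.

End ParityCount.

Section Brackets.
Variables (K : numFieldType) (L : lieSuperalgebra K).
Implicit Types (x y z : L) (A B : set L).

Let axL := lsa_axioms L.

Lemma part_subspace i : subspace (@part K L i).
Proof. exact: (Defs.part_subspace axL). Qed.

Lemma part_sum x : exists x0 x1, [/\ part false x0, part true x1 & x = x0 + x1].
Proof. exact: (Defs.part_sum axL). Qed.

Lemma part_disjoint i x : part i x -> part (~~ i) x -> x = 0.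
Proof. by case: i => /= h1 h2; apply: (part_direct axL). Qed.

Lemma part0 i : part i (0 : L).
Proof. exact: subspace0 (part_subspace i). Qed.

Lemma brDl x x' y : br (x + x') y = br x y + br x' y.
Proof. by have := br_linearl axL y 1 x x'; rewrite !scale1r. Qed.

Lemma brDr x y y' : br x (y + y') = br x y + br x y'.
Proof. by have := br_linearr axL x 1 y y'; rewrite !scale1r. Qed.

Lemma br0l y : br 0 y = 0 :> L.
Proof. by apply: (addrI (br 0 y)); rewrite -brDl !addr0. Qed.

Lemma br0r x : br x 0 = 0 :> L.
Proof. by apply: (addrI (br x 0)); rewrite -brDr !addr0. Qed.

Lemma brZl a x y : br (a *: x) y = a *: br x y.
Proof. by have := br_linearl axL y a x 0; rewrite !addr0 br0l addr0. Qed.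

Lemma brZr a x y : br x (a *: y) = a *: br x y.
Proof. by have := br_linearr axL x a y 0; rewrite !addr0 br0r addr0. Qed.

Lemma brNl x y : br (- x) y = - br x y.
Proof. by rewrite -scaleN1r brZl scaleN1r. Qed.

Lemma brNr x y : br x (- y) = - br x y.
Proof. by rewrite -scaleN1r brZr scaleN1r. Qed.

Lemma brBl x x' y : br (x - x') y = br x y - br x' y.
Proof. by rewrite brDl brNl. Qed.

Lemma brBr x y y' : br x (y - y') = br x y - br x y'.
Proof. by rewrite brDr brNr. Qed.

Lemma part_br i j x y : part i x -> part j y -> part (i (+) j) (br x y).
Proof. exact: (br_graded axL). Qed.

Lemma brC i j x y : part i x -> part j y ->
  br x y = - ((-1) ^+ (i && j) *: br y x).
Proof. exact: (br_skew axL). Qed.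

Lemma br_jacobi i j x y z : part i x -> part j y ->
  br x (br y z) = br (br x y) z + (-1) ^+ (i && j) *: br y (br x z).
Proof. exact: (Defs.br_jacobi axL). Qed.

Lemma brC_eq0 i j x y : part i x -> part j y -> br x y = 0 -> br y x = 0.
Proof. by move=> xi yj e; rewrite (brC yj xi) e scaler0 oppr0. Qed.

Lemma br_even_alt x : part false x -> br x x = 0.
Proof.
move=> x0; have /eqP := brC x0 x0; rewrite /= scale1r -addr_eq0 -mulr2n.
by rewrite -scaler_nat scaler_eq0 pnatr_eq0 /= => /eqP.
Qed.

Definition homogeneous x : Prop := exists i, part i x.

Definition graded A : Prop := forall x0 x1,
  part false x0 -> part true x1 -> A (x0 + x1) -> A x0 /\ A x1.

Lemma part_sum_inj x0 x1 y0 y1 : part false x0 -> part true x1 ->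
  part false y0 -> part true y1 -> x0 + x1 = y0 + y1 -> x0 = y0 /\ x1 = y1.
Proof.
move=> px0 px1 py0 py1 e; have s0 := part_subspace false.
have s1 := part_subspace true.
have e0 : x0 - y0 = y1 - x1.
  by apply/eqP; rewrite subr_eq addrAC eq_sym subr_eq addrC -e.
have /eqP z0 : x0 - y0 = 0.
  apply: (@part_disjoint false); first exact: subspaceB.
  by rewrite e0; apply: subspaceB.
move: (z0); rewrite e0 !subr_eq0 => /eqP ->.
by move: z0; rewrite subr_eq0 => /eqP ->.
Qed.

Lemma gradedT : graded setT.
Proof. by []. Qed.

Lemma graded_set0 : graded [set 0].
Proof.
move=> x0 x1 p0 p1 /= e; apply: part_sum_inj => //; try exact: part0.
by rewrite addr0.
Qed.

Lemma graded_part i : graded (part i).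
Proof.
have s := part_subspace i.
case: i s => s x0 x1 p0 p1 h.
  split=> //; rewrite (_ : x0 = 0); first exact: part0.
  apply: (@part_disjoint false) => //=.
  by rewrite -[x0](addrK x1); apply: subspaceB.
split=> //; rewrite (_ : x1 = 0); first exact: part0.
apply: (@part_disjoint true) => //=.
by rewrite -[x1](addKr x0) addrC; apply: subspaceB.
Qed.

Lemma br_span_mem A B x y : A x -> B y -> br_span A B (br x y).
Proof. by move=> Ax By; apply: mem_span; exists x => //; exists y. Qed.

Lemma br_span_subspace A B : subspace (br_span A B).
Proof. exact: span_subspace. Qed.

Lemma br_span_min A B T : subspace T ->
  (forall x y, A x -> B y -> T (br x y)) -> br_span A B `<=` T.
Proof. by move=> sT h; apply: span_min => // u [x Ax [y By <-]]; apply: h. Qed.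

Lemma graded_mem A x : graded A -> A x ->
  exists x0 x1, [/\ part false x0, part true x1, x = x0 + x1, A x0 & A x1].
Proof.
move=> gA; have [x0 [x1 [p0 p1 ->]]] := part_sum x.
by move=> /(gA _ _ p0 p1)[A0 A1]; exists x0, x1.
Qed.

(** The vectors whose two components lie in the span form a subspace [T] containing the generating
    brackets; uniqueness of components concludes. *)
Lemma graded_br_span A B : graded A -> graded B -> graded (br_span A B).
Proof.
move=> gA gB; set S := br_span A B.
have sS : subspace S := br_span_subspace A B.
have s0 := part_subspace false; have s1 := part_subspace true.
pose T := [set x | exists x0 x1,
  [/\ part false x0, part true x1, x = x0 + x1, S x0 & S x1]].
have sT : subspace T.
  split; first by exists 0, 0; rewrite addr0; split=> //;
    try exact: part0; exact: subspace0.
  move=> a u v [u0 [u1 [pu0 pu1 -> Su0 Su1]]] [v0 [v1 [pv0 pv1 -> Sv0 Sv1]]].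
  exists (a *: u0 + v0), (a *: u1 + v1); split; try exact: sS.2.
  - exact: s0.2.
  - exact: s1.2.
  by rewrite scalerDr addrACA.
suff ST : S `<=` T.
  move=> x0 x1 p0 p1 /ST[y0 [y1 [q0 q1 e Sy0 Sy1]]].
  by have [-> ->] := part_sum_inj p0 p1 q0 q1 e.
apply: br_span_min => // x y /(graded_mem gA)[x0 [x1 [px0 px1 -> Ax0 Ax1]]].
move=> /(graded_mem gB)[y0 [y1 [py0 py1 -> By0 By1]]].
exists (br x0 y0 + br x1 y1), (br x0 y1 + br x1 y0); split.
- by apply: (subspaceD s0); [exact: part_br px0 py0|exact: part_br px1 py1].
- by apply: (subspaceD s1); [exact: part_br px0 py1|exact: part_br px1 py0].
- by rewrite brDl !brDr [RHS]addrACA [br x1 y0 + _]addrC.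
- by apply: (subspaceD sS); apply: br_span_mem.
- by apply: (subspaceD sS); apply: br_span_mem.
Qed.

Definition derived : set L := br_span setT setT.

Lemma derived_subspace : subspace derived.
Proof. exact: br_span_subspace. Qed.

Lemma graded_derived : graded derived.
Proof. exact: graded_br_span gradedT gradedT. Qed.

Lemma derived_br x y : derived (br x y).
Proof. exact: br_span_mem. Qed.

Record hbasis (I : finType) (e : I -> L) (p : I -> bool) : Prop := HBasis {
  hbasis_part : forall i, part (p i) (e i);
  hbasis_indep : indep [set 0] e;
  hbasis_span : forall v, spanned [set 0] e v
}.

Lemma hbasisE (I : finType) (e : I -> L) p v : hbasis e p ->
  exists c : I -> K, v = \sum_i c i *: e i.
Proof. by case=> _ _ /(_ v)[c /= /subr0_eq]; exists c. Qed.

Lemma hbasis_ext (I : finType) (e : I -> L) p T : hbasis e p ->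
  subspace T -> (forall i, T (e i)) -> forall v, T v.
Proof.
by case=> _ _ se sT Te v; apply: (spanned_min sT _ Te (se v)) => ? ->; apply: sT.1.
Qed.

(** When a vector of parity [b] is expanded in [e'], the terms of the other parity add up to a
    vector of both parities, hence to 0. So Steinitz applies inside each parity. *)
Lemma hbasis_le (I I' : finType) (e : I -> L) (e' : I' -> L) p p' b :
  hbasis e p -> hbasis e' p' ->
  (#|[pred i | p i == b]| <= #|[pred i | p' i == b]|)%N.
Proof.
move=> he he'; rewrite -(card_sig (fun i => p i == b)).
rewrite -(card_sig (fun i => p' i == b)).
apply: (@steinitz _ _ [set 0] _ _
  (fun i : {i | p i == b} => e (val i)) (fun i : {i | p' i == b} => e' (val i))).
- exact: subspace_set0.
- exact: indep_inj val_inj (hbasis_indep he).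
move=> [i /= /eqP pi].
have [c ec] := hbasisE (e i) he'; exists (c \o val).
rewrite -(big_sub [pred i | p' i == b] (fun i => c i *: e' i)).
rewrite (eq_bigl (fun i => p' i == b)) //=.
have s := part_subspace b; have s' := part_subspace (~~ b).
apply: (@part_disjoint b).
  apply: subspaceB => //; first by rewrite -pi; apply: hbasis_part he _.
  apply: subspace_sum => // j /eqP <-; apply: subspaceZ; last first.
    exact: hbasis_part he' _.
  exact: part_subspace.
rewrite ec (bigID (fun i => p' i == b)) /= addrC addrK.
apply: subspace_sum => // j pj; apply: subspaceZ => //.
rewrite (_ : ~~ b = p' j); first exact: hbasis_part he' _.
by clear -pj; case: (p' j) b pj => -[].
Qed.

Lemma hbasis_card2 (I I' : finType) (e : I -> L) (e' : I' -> L) p p' b :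
  hbasis e p -> hbasis e' p' ->
  #|[pred i | p i == b]| = #|[pred i | p' i == b]|.
Proof.
by move=> h h'; apply/eqP; rewrite eqn_leq !(hbasis_le _ h h', hbasis_le _ h' h).
Qed.

Definition famparity (I J : Type) : I + J -> bool := 
  famcat (fun=> false) (fun=> true).

Lemma superdim_hbasis m n : superdim L m n ->
  exists e : 'I_m + 'I_n -> L, hbasis e (@famparity _ _).
Proof.
move=> [[u [pu iu su]] [v [pv iv sv]]].
have s0 := @subspace_set0 K L.
exists (famcat u v); split=> [[i|i]||x]; [exact: pu|exact: pv| |].
- apply: (@indep_famcat _ _ [set 0] (part true)) => //.
  + exact: part_subspace.
  + by move=> ? ->; apply: part0.
  move=> c h; apply: iu => /=; apply: (@part_disjoint false) => //.
  by apply: subspace_sum => [|i _]; [|apply: subspaceZ => //];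
    exact: part_subspace.
have [x0 [x1 [/su[c h0] /sv[c' h1] ->]]] := part_sum x.
exists (famcat c c'); rewrite sum_famcat /=.
by rewrite opprD addrACA; move: h0 h1 => /= -> ->; rewrite addr0.
Qed.

Lemma hbasis_card (I : finType) (e : I -> L) p m n :
  hbasis e p -> superdim L m n ->
  #|[pred i | p i == false]| = m /\ #|[pred i | p i == true]| = n.
Proof.
move=> he /superdim_hbasis[e' he'].
rewrite !(hbasis_card2 _ he he') !card_famcat !card_const !card_ord /=.
by rewrite !mul1n !mul0n addn0.
Qed.

End Brackets.

(** * Upper bounds for the multiplier *)

Section JacobiClosed.
Variables (K : numFieldType) (L : lieSuperalgebra K).

(* The closure properties of the set of pairs (x, y) for which the class of
   x /\ y lies in a given subspace of the second exterior power of L modulo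
   the relations x /\ [y, z] = [x, y] /\ z +- y /\ [x, z]. *)
Record jacobi_closed (th : L -> L -> Prop) : Prop := JacobiClosed {
  th_subspacel : forall y, subspace [set x | th x y];
  th_subspacer : forall x, subspace [set y | th x y];
  th_sym : forall i j x y, part i x -> part j y -> th x y -> th y x;
  th_diag : forall x, part false x -> th x x;
  th_jacobi : forall i j x y z, part i x -> part j y ->
    th (br x y) z -> th y (br x z) -> th x (br y z)
}.

End JacobiClosed.

(** * Brackets of lifts modulo [F, R] *)

Section Presentation.
Variables (K : numFieldType) (L : lieSuperalgebra K) (P : free_presentation L).

Local Notation F := (fp_alg P).
Local Notation f := (fp_map P).
Local Notation R := (fp_rel P).
Local Notation FR := (br_span setT R).

Lemma fp_br (u v : F) : f (br u v) = br (f u) (f v).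
Proof. exact: (fp_hom P).2. Qed.

Lemma fp_part i (u : F) : part i u -> part i (f u).
Proof. exact: (fp_hom P).1. Qed.

Lemma fp_lift_part i (x : L) : part i x -> exists2 u : F, part i u & f u = x.
Proof.
move=> px; have [u fu] := fp_surj P x; subst x.
have [u0 [u1 [p0 p1 e]]] := part_sum u.
have := @graded_part _ L i _ _ (fp_part p0) (fp_part p1).
rewrite -linearD -e => /(_ px)[f0 f1].
case: i px f0 f1 => px f0 f1; [exists u1|exists u0] => //.
  rewrite e linearD (_ : f u0 = 0) ?add0r //.
  exact: (part_disjoint (fp_part p0)).
rewrite e linearD (_ : f u1 = 0) ?addr0 //.
exact: (part_disjoint (fp_part p1)).
Qed.

Lemma fp_rel_subspace : subspace R.
Proof.
split=> [|a u v]; rewrite /fp_rel /= ?linear0 // => fu fv.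
by rewrite linearP fu fv scaler0 addr0.
Qed.

Lemma graded_fp_rel : graded R.
Proof.
move=> u0 u1 p0 p1; rewrite /fp_rel /= linearD.
exact: (graded_set0 (fp_part p0) (fp_part p1)).
Qed.

Lemma FR_subspace : subspace FR.
Proof. exact: br_span_subspace. Qed.

Lemma FR_r (u r : F) : R r -> FR (br u r).
Proof. by move=> Rr; apply: br_span_mem. Qed.

(** The sign of skew-symmetry depends on parities, so both arguments are split; the components of
    [r] stay in [R] because [R] is graded. *)
Lemma FR_l (r u : F) : R r -> FR (br r u).
Proof.
move=> /(graded_mem graded_fp_rel)[r0 [r1 [p0 p1 -> R0 R1]]].
have [u0 [u1 [q0 q1 ->]]] := part_sum u.
have h i j s t : part i s -> part j t -> R s -> FR (br s t).
  move=> ps pt Rs; rewrite (brC ps pt).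
  apply: (subspaceN FR_subspace); apply: (subspaceZ _ FR_subspace).
  exact: FR_r.
rewrite brDl !brDr.
have s := FR_subspace.
apply: (subspaceD s); apply: (subspaceD s); [exact: (h _ _ _ _ p0 q0)|
  exact: (h _ _ _ _ p0 q1)|exact: (h _ _ _ _ p1 q0)|exact: (h _ _ _ _ p1 q1)].
Qed.

Lemma FR_rel : FR `<=` R.
Proof.
apply: br_span_min => [|u r _ fr]; first exact: fp_rel_subspace.
by rewrite /fp_rel /= fp_br fr br0r.
Qed.

Lemma FR_congr (u u' v v' : F) :
  f u = f u' -> f v = f v' -> FR (br u v - br u' v').
Proof.
move=> eu ev.
have -> : br u v - br u' v' = br (u - u') v + br u' (v - v').
  by rewrite brBl brBr addrA subrK.
apply: (subspaceD FR_subspace); [apply: FR_l|apply: FR_r];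
  by rewrite /fp_rel /= linearB ?eu ?ev subrr.
Qed.

(** This reads: x /\ y has its class in T/[F, R]. Quantifying over all lifts gives a relation on
    [L]; by [lifted_inE] one pair of lifts decides it. *)
Definition lifted_in (T : set F) (x y : L) : Prop :=
  forall u v : F, f u = x -> f v = y -> T (br u v).

Section Lifted.
Variable T : set F.
Hypotheses (sT : subspace T) (FRT : FR `<=` T).

Lemma lifted_inE (u v : F) : T (br u v) -> lifted_in T (f u) (f v).
Proof.
move=> Tuv u' v' eu ev; rewrite -[br u' v'](subrK (br u v)).
by apply: (subspaceD sT) => //; apply: FRT; apply: FR_congr.
Qed.

Lemma lifted_in_jacobi : jacobi_closed (lifted_in T).
Proof.
split.
- move=> y; have [v <-] := fp_surj P y; split=> /=.
    rewrite -(linear0 f); apply: lifted_inE; rewrite br0l; exact: subspace0.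
  move=> a x x' h h'; have [u eu] := fp_surj P x.
  have [u' eu'] := fp_surj P x'.
  rewrite -eu -eu' -linearP; apply: lifted_inE; rewrite brDl brZl.
  by apply: sT.2; [apply: h|apply: h'].
- move=> x; have [u <-] := fp_surj P x; split=> /=.
    rewrite -(linear0 f); apply: lifted_inE; rewrite br0r; exact: subspace0.
  move=> a y y' h h'; have [v ev] := fp_surj P y.
  have [v' ev'] := fp_surj P y'.
  rewrite -ev -ev' -linearP; apply: lifted_inE; rewrite brDr brZr.
  by apply: sT.2; [apply: h|apply: h'].
- move=> i j x y /fp_lift_part[u pu <-] /fp_lift_part[v pv <-] h.
  apply: lifted_inE; rewrite (brC pv pu).
  by apply: (subspaceN sT); apply: (subspaceZ _ sT); apply: h.
- move=> x /fp_lift_part[u pu <-]; apply: lifted_inE.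
  by rewrite br_even_alt //; apply: subspace0.
move=> i j x y z /fp_lift_part[u pu <-] /fp_lift_part[v pv <-] h h'.
have [w ew] := fp_surj P z; subst z.
rewrite -fp_br; apply: lifted_inE; rewrite (br_jacobi _ pu pv).
apply: (subspaceD sT); last apply: (subspaceZ _ sT).
  by apply: h => //; rewrite fp_br.
by apply: h' => //; rewrite fp_br.
Qed.

End Lifted.

(* The classes of the brackets of lifts span [F, F] modulo [F, R], a space of
   dimension dim M(L) + dim [L, L]. *)
Lemma multiplier_le (J I : finType) (a b : J -> L) (l : I -> L) d :
  (forall th, jacobi_closed th -> (forall j, th (a j) (b j)) ->
     forall x y, th x y) ->
  indep [set 0] l -> (forall i, derived (l i)) -> multiplier_dim_of P d ->
  (d + #|I| <= #|J|)%N.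
Proof.
move=> full il Dl [e [Ae ie _]].
have [/choice[ta fa] /choice[tb fb]] : (forall j, exists u, f u = a j) /\
  (forall j, exists u, f u = b j) by split=> j; apply: fp_surj.
pose s j := br (ta j) (tb j).
have sB := FR_subspace.
have sS := spanned_subspace s sB.
have fullS (u v : F) : spanned FR s (br u v).
  apply: (full _ (lifted_in_jacobi sS (@sub_spanned _ _ FR _ s))) (erefl _) (erefl _).
  move=> j; rewrite -fa -fb; apply: lifted_inE => //.
    exact: (@sub_spanned _ _ FR _ s).
  exact: (spanned_mem s j).
have DS : br_span setT setT `<=` spanned FR s.
  by apply: br_span_min => // u v _ _; apply: fullS.
have /choice[w hw] i : exists w, br_span setT setT w /\ f w = l i.
  suff : @derived K L `<=` [set x | exists w, br_span setT setT w /\ f w = x].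
    by apply.
  apply: br_span_min => [|x y _ _].
    split; first by exists 0; rewrite linear0; split=> //;
      apply: subspace0; apply: br_span_subspace.
    move=> c x y [u [Du <-]] [v [Dv <-]]; exists (c *: u + v).
    by rewrite linearP; split=> //; apply: (br_span_subspace _ _).2.
  have [u eu] := fp_surj P x; have [v ev] := fp_surj P y.
  by exists (br u v); rewrite fp_br eu ev; split=> //; apply: br_span_mem.
rewrite -[d]card_ord addnC -card_sum.
apply: (@steinitz _ _ FR _ _ (famcat w e) s) => //; last first.
  by case=> i; apply: DS => /=; [case: (hw i)|case: (Ae i)].
(* [w] lifts independent vectors of [L, L], so it is independent modulo [R], whereas [e] lies in [R]
   and is independent modulo [F, R]. *)
apply: (indep_famcat (A := R)) => //; first exact: fp_rel_subspace.
- exact: FR_rel.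
- by move=> j; case: (Ae j).
move=> c; rewrite /fp_rel /= linear_sum => h; apply: il; rewrite /= -[RHS]h.
by apply: eq_bigr => i _; rewrite linearZ /= (hw i).2.
Qed.

End Presentation.

(** * Unordered pairs indexing the exterior square *)

Section PairCount.
Variables (I : finType) (p : I -> bool).
Implicit Types (i j a b z : I) (Q : {set I}).
Local Open Scope set_scope.

Lemma set2_eqP i j a b :
  [set i; j] = [set a; b] <-> (i = a /\ j = b) \/ (i = b /\ j = a).
Proof.
split=> [/setP e|[[-> ->] //|[-> ->]]]; last by rewrite finset.setUC.
have := e i; have := e j; have := e a; have := e b; rewrite !inE !eqxx /= !orbT.
move=> /orP[]/eqP eb /orP[]/eqP ea /esym/orP[]/eqP ej /esym/orP[]/eqP ei;
  subst; by [left|right].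
Qed.

(* The pairs {i, j} indexing a basis of the exterior square of a superspace:
   an odd vector, but not an even one, may be paired with itself. *)
Definition exterior_pairs : {set {set I}} :=
  [set A : {set I} | #|A| == 2%N] :|: [set [set i] | i : I & p i].

Lemma exterior_pairsE i j :
  ([set i; j] \in exterior_pairs) = (i != j) || p i.
Proof.
rewrite !inE cards2; case: (eqVneq i j) => //= <-; rewrite finset.setUid.
apply/imsetP/idP => [[k]|pi]; last by exists i; rewrite ?inE.
by rewrite inE => pk /set1_inj ->.
Qed.

Lemma exterior_pairs_ex A : A \in exterior_pairs ->
  exists i j, A = [set i; j].
Proof.
rewrite !inE => /orP[/cards2P[i [j [_ ->]]]|/imsetP[i _ ->]]; first by exists i, j.
by exists i, i; rewrite finset.setUid.
Qed.

Lemma card_exterior_pairs :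
  #|exterior_pairs| = ('C(#|I|, 2) + #|[pred i | p i == true]|)%N.
Proof.
rewrite /exterior_pairs cardsU [X in (_ - X)%N]eq_card0 ?subn0; last first.
  move=> A; rewrite !inE; apply/negP => /andP[/eqP A2 /imsetP[i _ Ai]].
  by rewrite Ai cards1 in A2.
congr (_ + _)%N; first by rewrite -cardsT -cards_draws; apply: eq_card => A;
  rewrite !inE finset.subsetT.
rewrite card_imset; last exact: set1_inj.
by apply: eq_card => i; rewrite !inE eqb_id.
Qed.

Definition pairs_with z Q : {set {set I}} := [set [set q; z] | q in Q].

Lemma card_pairs_with z Q : #|pairs_with z Q| = #|Q|.
Proof.
by rewrite card_in_imset => [//|i j _ _ /set2_eqP[[-> _]|[-> <-]]].
Qed.

Lemma pairs_withE z Q i j : ([set i; j] \in pairs_with z Q) =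
  (i \in Q) && (j == z) || (j \in Q) && (i == z).
Proof.
apply/imsetP/orP => [[q qQ /set2_eqP[[-> ->]|[-> ->]]]|[]/andP[h /eqP ->]].
- by left; rewrite qQ eqxx.
- by right; rewrite qQ eqxx.
- by exists i.
by exists j => //; rewrite finset.setUC.
Qed.

End PairCount.

Section PairBound.
Variables (K : numFieldType) (L : lieSuperalgebra K) (P : free_presentation L).
Variables (I J : finType) (e : I -> L) (p : I -> bool) (l : J -> L) (d : nat).
Hypothesis (he : hbasis e p).

Lemma jacobi_closed_hbasis (th : L -> L -> Prop) : jacobi_closed th ->
  (forall i j, th (e i) (e j)) -> forall x y, th x y.
Proof.
move=> ht the x y.
apply: (hbasis_ext he (th_subspacel ht y) _ x) => i.
apply: (hbasis_ext he (th_subspacer ht (e i)) _ y) => j; exact: the.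
Qed.

(** The pairs {q, z} are withheld from the spanning set, and the second hypothesis asks that they be
    recovered from the others. The first one ensures that {z, z} is withheld only if it was counted,
    so exactly [#|Q|] pairs are saved. *)
Lemma multiplier_le_pairs (z : I) (Q : {set I}) :
  (z \in Q -> p z) ->
  (forall th, jacobi_closed th ->
    (forall i j, ~~ ((i \in Q) && (j == z)) -> ~~ ((j \in Q) && (i == z)) ->
       th (e i) (e j)) ->
    forall q, q \in Q -> th (e q) (e z)) ->
  indep [set 0] l -> (forall j, derived (l j)) -> multiplier_dim_of P d ->
  (d + #|J| + #|Q| <= 'C(#|I|, 2) + #|[pred i | p i == true]|)%N.
Proof.
move=> zQ full il Dl hd; rewrite -card_exterior_pairs -(card_pairs_with z Q).
set Om := exterior_pairs p; set Rm := pairs_with z Q.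
have RmOm : Rm \subset Om.
  apply/fintype.subsetP => A /imsetP[q qQ ->]; rewrite exterior_pairsE.
  by case: (eqVneq q z) => //= eq; rewrite eq zQ // -eq.
rewrite -(cardsID Rm Om) (finset.setIidPr RmOm) addnC leq_add2l.
have /choice[ab hab] : forall A : {A | A \in (Om :\: Rm)%SET},
    exists q : I * I, val A = [set q.1; q.2]%SET.
  move=> [A] /=; rewrite finset.in_setD => /andP[_ /exterior_pairs_ex].
  by case=> i [j ->]; exists (i, j).
rewrite -(card_sig (fun A => A \in (Om :\: Rm)%SET)).
apply: (@multiplier_le _ _ P _ J (e \o fst \o ab) (e \o snd \o ab) l) => // th ht.
move=> hth; apply: (jacobi_closed_hbasis ht) => i j.
have symth i' j' : th (e i') (e j') -> th (e j') (e i').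
  by apply: (th_sym ht); apply: hbasis_part he _.
have nRm i' j' : [set i'; j']%SET \notin Rm -> th (e i') (e j').
  move=> nr; case OmA : ([set i'; j']%SET \in Om).
    have SA : [set i'; j']%SET \in (Om :\: Rm)%SET by rewrite finset.in_setD nr.
    pose A := exist (fun A => A \in (Om :\: Rm)%SET) _ SA.
    have := hth A; have := hab A.
    by move=> /= /set2_eqP[[-> ->]|[-> ->]] // /symth.
  (* Outside [Om] only a pair {j', j'} with [e j'] even is left, and there x /\ x = 0. *)
  move: OmA; rewrite exterior_pairsE; case: (eqVneq i' j') => //= -> /negbT pj.
  by apply: (th_diag ht); rewrite -(negbTE pj); apply: hbasis_part he _.
have thQ : forall q, q \in Q -> th (e q) (e z).
  apply: full => // i' j' n1 n2; apply: nRm.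
  by rewrite pairs_withE negb_or n1.
have [|/nRm //] := boolP ([set i; j]%SET \in Rm).
by rewrite pairs_withE => /orP[]/andP[/thQ h /eqP ->] //; apply: symth.
Qed.

End PairBound.

(** * Bases adapted to [L, L] and the three upper bounds *)

Section AdaptedBases.
Variables (K : numFieldType) (L : lieSuperalgebra K) (m n : nat).
Hypothesis dimL : superdim L m n.

Local Notation D := (@derived K L).

Lemma homogeneous_span (A B : set L) (I : finType) (e : I -> L) :
  subspace B -> graded A ->
  A `&` [set v | homogeneous v] `<=` spanned B e -> A `<=` spanned B e.
Proof.
move=> sB gA h v /(graded_mem gA)[v0 [v1 [p0 p1 -> A0 A1]]].
apply: (subspaceD (spanned_subspace e sB)); apply: h; split=> //.
  by exists false.
by exists true.
Qed.

Lemma graded_extend (B A : set L) (I : finType) (e0 : I -> L) :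
  subspace B -> graded A -> indep B e0 ->
  exists k (e : 'I_k -> L), [/\ forall i, A (e i) /\ homogeneous (e i),
    indep B (famcat e0 e) & A `<=` spanned B (famcat e0 e)].
Proof.
move=> sB gA ie0; have [s hs] := superdim_hbasis dimL.
have ss v : spanned B s v.
  by apply: (spannedW (B := [set 0])) (hbasis_span hs v) => ? ->; case: sB.
have [//|//|k [e [Ae ie se]]] := @indep_extend _ _ B
    (A `&` [set v | homogeneous v]) I _ e0 s sB ie0.
by exists k, e; split=> //; apply: homogeneous_span.
Qed.

Lemma hbasis_of_indep (I : finType) (e : I -> L) :
  (forall i, homogeneous (e i)) -> indep [set 0] e ->
  (forall v, spanned [set 0] e v) -> exists p, hbasis e p.
Proof. by move=> /choice[p ep] ie se; exists p; split. Qed.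

(** The first block completes [e0] modulo [L, L], the second completes [z] inside [L, L]. Thus the
    generators kept aside and the vector [z] whose pairs are removed all have indices of their
    own. *)
Lemma adapted_basis (I : finType) (e0 : I -> L) z :
  (forall i, homogeneous (e0 i)) -> indep D e0 ->
  D z -> homogeneous z -> z != 0 ->
  exists k (e : 'I_k -> L) k1 (l : 'I_k1 -> L) p,
    [/\ hbasis (famcat (famcat e0 e) (famcat (fun _ : unit => z) l)) p,
        forall j, D (famcat (fun _ : unit => z) l j)
      & D `<=` spanned [set 0] (famcat (fun _ : unit => z) l)].
Proof.
move=> he0 ie0 Dz hz z0; have s0 := @subspace_set0 K L.
have sD := derived_subspace L.
have D0 : [set 0] `<=` D by move=> ? ->; case: sD.
have [k [e [Ae ie se]]] := graded_extend sD (@gradedT _ _) ie0.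
have iz : indep [set 0] (fun _ : unit => z).
  move=> c; rewrite (big_pred1 tt) => [|[] //] /eqP.
  by rewrite scaler_eq0 (negPf z0) orbF => /eqP c0 [].
have [k1 [l [Al il sl]]] := graded_extend s0 (@graded_derived _ L) iz.
have Dl j : D (famcat (fun _ : unit => z) l j).
  by case: j => [//|j]; case: (Al j).
have [||v|p hp] := @hbasis_of_indep _
    (famcat (famcat e0 e) (famcat (fun _ : unit => z) l)).
- case=> [[i|i]|[i|i]] //=; first by case: (Ae i).
  by case: (Al i).
- exact: indep_famcat sD D0 Dl ie il.
- by apply: (spanned_famcat s0 D0 sl); apply: se.
by exists k, e, k1, l, p.
Qed.

Section Bound.
Variables (P : free_presentation L) (d : nat).
Hypothesis hd : multiplier_dim_of P d.

Lemma multiplier_le_adapted (G J : finType) (e : G -> L) (l : J -> L) p z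
    (Q : {set G + J}) :
  hbasis (famcat e l) p -> (forall j, D (l j)) ->
  (inr z \in Q -> p (inr z)) ->
  (forall th, jacobi_closed th ->
    (forall i j, ~~ ((i \in Q) && (j == inr z)) ->
       ~~ ((j \in Q) && (i == inr z)) -> th (famcat e l i) (famcat e l j)) ->
    forall q, q \in Q -> th (famcat e l q) (l z)) ->
  (d + #|J| + #|Q| <= 'C(m + n, 2) + n)%N /\ (m + n = #|G| + #|J|)%N.
Proof.
move=> he Dl zQ full.
have [cm cn] := hbasis_card he dimL.
have cI : (m + n = #|G| + #|J|)%N.
  rewrite -card_sum -cm -cn -(cardC [pred i | p i == true]) addnC.
  by congr (_ + _)%N; apply: eq_card => i; rewrite !inE; case: (p i).
split=> //; rewrite cI -card_sum -[X in (_ <= _ + X)%N]cn.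
apply: (multiplier_le_pairs he zQ full _ Dl hd).
exact: indep_inj inr_inj (hbasis_indep he).
Qed.

(* With z = [x, w], the relation g /\ z = [g, x] /\ w +- x /\ [g, w] removes the
   pairs {g, z} for all the generators g other than x0. *)
Lemma multiplier_le_line x0 x w :
  homogeneous x0 -> ~ D x0 -> homogeneous x -> homogeneous w ->
  (exists a, D (x - a *: x0)) -> (exists a, D (w - a *: x0)) ->
  br x w != 0 -> (d + (m + n) <= 'C(m + n, 2) + n + 1)%N.
Proof.
move=> hx0 Dx0 hx hw [a Dx] [b Dw] z0.
have sD := derived_subspace L.
have i0 : indep D (fun _ : unit => x0).
  move=> c; rewrite (big_pred1 tt) => [|[] //] Dc [].
  by apply/eqP/negPn/negP => c0; apply: Dx0; apply: subspaceZK c0 Dc.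
have hz : homogeneous (br x w).
  by case: hx hw => i xi [j wj]; exists (i (+) j); apply: part_br.
have [k [e [k1 [l [p [he Dl sl]]]]]] :=
  adapted_basis (fun=> hx0) i0 (derived_br x w) hz z0.
(* [Q] is the block [e], that is, the generators other than [x0]. *)
pose Q := [set i : (unit + 'I_k) + (unit + 'I_k1) |
  famcat (famcat xpred0 xpredT) xpred0 i == true]%SET.
have cQ : #|Q| = k.
  by rewrite cardsE !card_famcat !card_const card_ord /= !mul0n mul1n !addn0.
have [|th ht thQ q qQ|le eN] :=
  @multiplier_le_adapted _ _ _ _ p (inl tt) Q he Dl.
- by rewrite inE.
- have [i qi] : exists i, part i (famcat
     (famcat (fun _ : unit => x0) e) (famcat (fun _ : unit => br x w) l) q).
    by exists (p q); apply: hbasis_part he _.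
  case: hx hw => ix px [iw pw].
  have sr v := th_subspacer ht v; have sl' v := th_subspacel ht v.
  have thDD u v : D u -> D v -> th u v.
    move=> Du Dv.
    apply: (spanned_min (sl' v) _ _ (sl _ Du)) => [? ->|j]; first by case: (sl' v).
    apply: (spanned_min (sr _) _ _ (sl _ Dv)) => [? ->|j']; first exact: (subspace0 (sr _)).
    by apply: (thQ (inr j) (inr j')); rewrite inE.
  have thx0D v : D v -> th x0 v.
    move=> Dv.
    apply: (spanned_min (sr _) _ _ (sl _ Dv)) => [? ->|j']; first exact: (subspace0 (sr _)).
    by apply: (thQ (inl (inl tt)) (inr j')); rewrite inE.
  have line y c v : D (y - c *: x0) -> D v -> th y v.
    move=> Dy Dv; rewrite -[y](subrK (c *: x0)).
    apply: (subspaceD (sl' v)); first exact: thDD.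
    by apply: (subspaceZ _ (sl' v)); apply: thx0D.
  (* [q, x] and [q, w] lie in [L, L], while [w] and [x] lie in K x0 + [L, L]: every pair needed here
     has been kept. *)
  apply: (th_jacobi ht qi px).
    apply: (th_sym ht pw (part_br qi px)).
    by apply: line Dw _; apply: derived_br.
  by apply: line Dx _; apply: derived_br.
- rewrite {}cQ card_sum !card_sum !card_unit !card_ord in le eN.
  (* N = 2 + k + k1, and [le] bounds d + (1 + k1) + k = d + N - 1. *)
  by move: le; rewrite eN; lia.
Qed.

(* As before, the pairs {q, z} with z = [x, y] are removed for the generators q
   other than x and y, but also for all the other basis vectors q of [L, L],
   and for q = z if z is odd; this compensates the lost generator unless
   [L, L] is the even line spanned by z. *)
Lemma multiplier_le_plane x y :
  homogeneous x -> homogeneous y ->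
  indep D (fun b : bool => if b then x else y) -> br x y != 0 ->
  (d + (m + n) <= 'C(m + n, 2) + n + 1)%N \/
  part false (br x y) /\ forall u, D u -> exists c, u = c *: br x y.
Proof.
move=> hx hy i0 z0.
have hz : homogeneous (br x y).
  by case: hx hy => i xi [j wj]; exists (i (+) j); apply: part_br.
have h0 b : homogeneous (if b then x else y) by case: b.
have [k [e [k1 [l [p [he Dl sl]]]]]] :=
  adapted_basis h0 i0 (derived_br x y) hz z0.
pose pz := p (inr (inl tt)).
pose Q := [set i : (bool + 'I_k) + (unit + 'I_k1) |
  famcat (famcat xpred0 xpredT) (famcat (fun=> pz) xpredT) i == true]%SET.
have cQ : #|Q| = (k + (pz + k1))%N.
  rewrite cardsE !card_famcat !card_const !card_ord card_unit /=.
  by rewrite mul0n !mul1n muln1 eqb_id.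
have [|th ht thQ q qQ|le eN] :=
  @multiplier_le_adapted _ _ _ _ p (inl tt) Q he Dl.
- by rewrite inE /= eqb_id.
- have [i qi] : exists i, part i (famcat
     (famcat (fun b : bool => if b then x else y) e)
     (famcat (fun _ : unit => br x y) l) q).
    by exists (p q); apply: hbasis_part he _.
  case: hx hy => ix px [iy py].
  (* [x] and [y] are outside [Q], so none of their pairs with [L, L] was removed. *)
  have thD b v : D v -> th (if b then x else y) v.
    have sr := th_subspacer ht (if b then x else y).
    move=> Dv; apply: (spanned_min sr _ _ (sl _ Dv)) => [? ->|j'].
      by case: sr.
    by apply: (thQ (inl (inl b)) (inr j')); rewrite inE ?andbF.
  apply: (th_jacobi ht qi px).
    apply: (th_sym ht py (part_br qi px)).
    by apply: (thD false); apply: derived_br.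
  by apply: (thD true); apply: derived_br.
- rewrite {}cQ card_sum !card_sum !card_unit !card_ord card_bool
    in le eN.
  (* Here N = 3 + k + k1, and [le] bounds d + N - 2 + pz + k1: one unit from [pz] or [k1] suffices,
     and without it [z] is even and spans [L, L]. *)
  have [h|h] := boolP (pz || (0 < k1)%N); [left|right].
    by move: le h; rewrite eN; case: (pz) => /=; lia.
  move: h; rewrite negb_or -leqNgt leqn0 => /andP[npz /eqP k10]; split.
    by rewrite -(negbTE npz); apply: (hbasis_part he (inr (inl tt))).
  move=> u /sl[c /= /subr0_eq ->]; exists (c (inl tt)).
  rewrite sum_famcat (big_pred1 tt) => [|[] //].
  by rewrite big1 ?addr0 //; subst k1 => -[].
Qed.

(* Here the second pair (u, v) also removes {x, z} and {y, z}. *)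
Lemma multiplier_le_planes x y u v :
  homogeneous x -> homogeneous y -> homogeneous u -> homogeneous v ->
  br x y != 0 -> (forall t, D t -> exists c, t = c *: br x y) ->
  br u v != 0 -> br x u = 0 -> br x v = 0 -> br y u = 0 -> br y v = 0 ->
  (d + (m + n) <= 'C(m + n, 2) + n + 1)%N.
Proof.
move=> hx hy hu hv z0 Dz uv0 xu xv yu yv.
have hz : homogeneous (br x y).
  by case: hx hy => i xi [j wj]; exists (i (+) j); apply: part_br.
(* No generator is kept aside: the prescribed family is empty and [Q] is the whole first block. *)
have i0 : indep D (fun _ : 'I_0 => 0 : L) by move=> c _ [].
have [[] //|k [e [k1 [l [p [he Dl sl]]]]]] :=
  adapted_basis _ i0 (derived_br x y) hz z0.
pose Q := [set i : ('I_0 + 'I_k) + (unit + 'I_k1) |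
  famcat xpredT xpred0 i == true]%SET.
have cQ : #|Q| = k.
  rewrite cardsE !card_famcat !card_const card_sum !card_ord /=.
  by rewrite !mul0n mul1n addn0.
have [|th ht thQ q qQ|le eN] :=
  @multiplier_le_adapted _ _ _ _ p (inl tt) Q he Dl.
- by rewrite inE.
- have [i qi] : exists i, part i (famcat
     (famcat (fun _ : 'I_0 => 0 : L) e) (famcat (fun _ : unit => br x y) l) q).
    by exists (p q); apply: hbasis_part he _.
  (* [u, v] is a nonzero multiple of [x, y], and t /\ [u, v] = [t, u] /\ v +- u /\ [t, v] vanishes
     when t commutes with u and v. This is used for t = x and t = y. *)
  have thz t : homogeneous t -> br t u = 0 -> br t v = 0 -> th t (br x y).
    move=> [it pt] tu tv; have [c uvE] := Dz _ (derived_br u v).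
    have sr := th_subspacer ht.
    have c0 : c != 0.
      by apply: contraNneq uv0 => c0; rewrite uvE c0 scale0r.
    apply: (subspaceZK (sr t) c0); rewrite /= -uvE.
    case: hu => iu pu; apply: (th_jacobi ht pt pu); rewrite ?tu ?tv.
      by case: (th_subspacel ht v).
    by case: (sr u).
  have thD t s : homogeneous t -> br t u = 0 -> br t v = 0 -> D s -> th t s.
    move=> pt tu tv /Dz[c ->]; apply: (subspaceZ _ (th_subspacer ht t)).
    exact: thz.
  case: (hx) (hy) => ix px [iy py].
  apply: (th_jacobi ht qi px).
    apply: (th_sym ht py (part_br qi px)).
    by apply: thD => //; apply: derived_br.
  by apply: thD => //; apply: derived_br.
- rewrite {}cQ card_sum !card_sum !card_unit !card_ord in le eN.
  by move: le; rewrite eN; lia.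
Qed.

End Bound.
End AdaptedBases.

(** * Non-abelian nilpotent superalgebras *)

Section HeisenbergBases.
Variables (K : numFieldType) (L : lieSuperalgebra K).

(* Structure constants of H(1,0) + A(k|l) in a homogeneous basis indexed by
   ((bool + unit) + 'I_k) + 'I_l: the two booleans stand for the generators
   x (true) and y (false) of H(1,0), and the unit for their bracket z. *)
Definition heis_const (I J : Type) (i j : ((bool + unit) + I) + J) : K :=
  match i, j with
  | inl (inl (inl b)), inl (inl (inl b')) => b%:R - b'%:R
  | _, _ => 0
  end.

Definition heis_basis k l (e : ((bool + unit) + 'I_k) + 'I_l -> L) : Prop :=
  hbasis e (@famparity _ _) /\
  forall i j, br (e i) (e j) = heis_const i j *: e (inl (inl (inr tt))).

End HeisenbergBases.

Section Dichotomy.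
Variables (K : numFieldType) (L : lieSuperalgebra K) (m n : nat).
Hypotheses (dimL : superdim L m n) (nilL : nilpotent L).

Local Notation D := (@derived K L).

Lemma br_neq0_homogeneous (x y : L) : br x y != 0 ->
  exists u v : L, [/\ homogeneous u, homogeneous v & br u v != 0].
Proof.
move=> xy0; apply: contrapT => nuv.
have h i j (u v : L) : part i u -> part j v -> br u v = 0.
  move=> ui vj; apply/eqP/negPn/negP => uv0; apply: nuv.
  by exists u, v; split=> //; [exists i|exists j].
move: xy0; have [x0 [x1 [px0 px1 ->]]] := part_sum x.
have [y0 [y1 [py0 py1 ->]]] := part_sum y.
rewrite brDl !brDr (h _ _ _ _ px0 py0) (h _ _ _ _ px0 py1).
by rewrite (h _ _ _ _ px1 py0) (h _ _ _ _ px1 py1) !addr0 eqxx.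
Qed.

(** Otherwise L = [L, L], and the descending central sequence stays at L. This is where nilpotency
    enters. *)
Lemma nilpotent_generator (x : L) : x != 0 ->
  exists2 x0 : L, homogeneous x0 & ~ D x0.
Proof.
move=> xn0; apply: contrapT => nx0.
have hD (y : L) : homogeneous y -> D y.
  by move=> hy; apply: contrapT => nDy; apply: nx0; exists y.
have DT : D = setT.
  apply/seteqP; split=> // y _; have [y0 [y1 [p0 p1 ->]]] := part_sum y.
  by apply: (subspaceD (derived_subspace L)); apply: hD; [exists false|exists true].
case: nilL => k hk; have : descending_central L k = setT.
  by elim: k {hk} => //= k; rewrite /descending_central /= => ->.
rewrite hk => /seteqP[_ /(_ x I)] /= x0; move: xn0; rewrite x0 eqxx //.
Qed.

(** Once the bound fails for some [P] and [d], each structural property of H(1,0) + A(k|l) follows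
    by contradiction: its failure would supply the data of one of the three bounds above. *)
Lemma multiplier_dichotomy (a b : L) : br a b != 0 ->
  (forall (P : free_presentation L) d, multiplier_dim_of P d ->
     (d + (m + n) <= 'C(m + n, 2) + n + 1)%N) \/
  exists k l (e : ((bool + unit) + 'I_k) + 'I_l -> L), heis_basis e.
Proof.
move=> ab0; have [|] := pselect (forall (P : free_presentation L) d,
  multiplier_dim_of P d -> (d + (m + n) <= 'C(m + n, 2) + n + 1)%N); first by left.
move=> /existsNP[P /existsNP[d /not_implyP[hd nle]]]; right.
have sD := derived_subspace L.
have [x [y [hx hy xy0]]] := br_neq0_homogeneous ab0.
have [g hg Dg] := nilpotent_generator xy0.
(* If [u] lies in [L, L], both vectors are 0 modulo any generator, and [g] serves; otherwise [u]
   itself is the generator kept aside. *)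
have central_h (u w : L) : homogeneous u -> homogeneous w -> D w -> br u w = 0.
  move=> hu hw Dw; apply/eqP/negPn/negP => uw0; apply: nle.
  have [Du|Du] := pselect (D u).
    by apply: (multiplier_le_line dimL hd hg Dg hu hw _ _ uw0);
      exists 0; rewrite scale0r subr0.
  apply: (multiplier_le_line dimL hd hu Du hu hw _ _ uw0).
    by exists 1; rewrite scale1r subrr; case: sD.
  by exists 0; rewrite scale0r subr0.
have centralr (u w : L) : D w -> br u w = 0.
  move=> /(graded_mem (@graded_derived _ L))[w0 [w1 [p0 p1 -> D0 D1]]].
  have [u0 [u1 [q0 q1 ->]]] := part_sum u.
  rewrite brDl !brDr !central_h ?addr0 //;
    by [exists false|exists true].
have centrall (u w : L) : D w -> br w u = 0.
  move=> /(graded_mem (@graded_derived _ L))[w0 [w1 [p0 p1 -> D0 D1]]].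
  have [u0 [u1 [q0 q1 ->]]] := part_sum u.
  rewrite brDl !brDr (brC_eq0 q0 p0) ?(brC_eq0 q0 p1) ?(brC_eq0 q1 p0)
    ?(brC_eq0 q1 p1) ?addr0 //; exact: centralr.
have sq0 (u : L) : homogeneous u -> br u u = 0.
  move=> hu; apply/eqP/negPn/negP => uu0; apply: nle.
  have Du : ~ D u by move=> Du; move: uu0; rewrite centralr // eqxx.
  by apply: (multiplier_le_line dimL hd hu Du hu hu _ _ uu0);
    exists 1; rewrite scale1r subrr; case: sD.
have Dx : ~ D x by move=> Dx; move: xy0; rewrite centrall // eqxx.
(* If [y] were a multiple of [x] modulo [L, L], the line bound would apply with [x] kept aside. *)
have ixy : indep D (fun b : bool => if b then x else y).
  move=> c; rewrite big_bool /= => Dc.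
  have c0 : c false = 0.
    apply/eqP/negPn/negP => c0; apply: nle.
    apply: (multiplier_le_line dimL hd hx Dx hx hy _ _ xy0).
      by exists 1; rewrite scale1r subrr; case: sD.
    exists (- ((c false)^-1 * c true)); apply: (subspaceZK sD c0).
    by rewrite scalerBr scalerA mulrN mulrA mulfV // mul1r scaleNr opprK addrC.
  case=> //; apply/eqP/negPn/negP => c1; apply: Dx.
  by apply: (subspaceZK sD c1); move: Dc; rewrite c0 scale0r addr0.
have [//|[pz Dz]] := multiplier_le_plane dimL hd hx hy ixy xy0.
set z := br x y in xy0 pz Dz.
(* [L, L] is even, so the two parities agree; for odd vectors, polarizing [u + v, u + v] = 0 gives 2
   [u, v] = 0. *)
have nonzero_even i j (u v : L) : part i u -> part j v -> br u v != 0 ->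
    i = false /\ j = false.
  move=> pu pv uv0.
  have puv : part false (br u v).
    have [c ->] := Dz _ (derived_br u v).
    by apply: subspaceZ => //; apply: part_subspace.
  have ij : i (+) j = false.
    apply/negP => ij; move: (part_br pu pv); rewrite ij => /(part_disjoint puv).
    by move/eqP; rewrite (negPf uv0).
  case: i j ij pu pv => -[] // _ pu pv.
  have : br (u + v) (u + v) = 0.
    apply: sq0; exists true; apply: subspaceD => //; exact: part_subspace.
  rewrite brDl !brDr !sq0; [|by exists true..].
  rewrite add0r addr0 (brC pv pu) /= expr1 scaleN1r opprK -mulr2n => /eqP.
  by rewrite -scaler_nat scaler_eq0 pnatr_eq0 (negPf uv0).
have [px py] : part false x /\ part false y.
  case: (hx) (hy) => i xi [j yj].
  by have [ei ej] := nonzero_even _ _ _ _ xi yj xy0; subst.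
(* Consequently odd vectors are central. *)
have even_even (u v : L) : part true u \/ part true v -> br u v = 0.
  have [u0 [u1 [q0 q1 eu]]] := part_sum u.
  have [v0 [v1 [r0 r1 ev]]] := part_sum v.
  have odd0 i j (s t : L) : part i s -> part j t -> i || j -> br s t = 0.
    move=> ps pt ij; apply/eqP/negPn/negP => st0.
    by have [ei ej] := nonzero_even _ _ _ _ ps pt st0; subst.
  case=> p.
    rewrite ev brDr (odd0 true false u v0) // (odd0 true true u v1) //.
    by rewrite addr0.
  rewrite eu brDl (odd0 false true u0 v) // (odd0 true true u1 v) //.
  by rewrite addr0.
have yx : br y x = - z by rewrite (brC py px) /= scale1r.
have xx : br x x = 0 by apply: sq0.
have yy : br y y = 0 by apply: sq0.
(* The even part of the centralizer of [x] and [y]. Two elements of it with nonzero bracket would be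
   the second pair of [multiplier_le_planes]. *)
pose W := [set w | [/\ part false w, br x w = 0 & br y w = 0]].
have WW u v : W u -> W v -> br u v = 0.
  move=> [pu xu yu] [pv xv yv]; apply/eqP/negPn/negP => uv0; apply: nle.
  by apply: (multiplier_le_planes dimL hd hx hy _ _ xy0 Dz uv0) => //;
    exists false.
have Wl u : W u -> br u x = 0 /\ br u y = 0.
  by move=> [pu xu yu]; rewrite (brC_eq0 px pu xu) (brC_eq0 py pu yu).
have s0 := @subspace_set0 K L.
pose e0 := famcat (fun b : bool => if b then x else y) (fun _ : unit => z).
have ie0 : indep [set 0] e0.
  apply: (indep_famcat sD _ _ ixy) => [? ->|[]|c]; first by case: sD.
    exact: derived_br.
  rewrite (big_pred1 tt) => [|[] //] /eqP.
  by rewrite scaler_eq0 (negPf xy0) orbF => /eqP c0 [].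
have [s hs] := superdim_hbasis dimL; have ss := hbasis_span hs.
have [//|//|k [u [Wu iu su]]] := @indep_extend _ _ _ W _ _ e0 s s0 ie0.
have [//|//|l [v [pv iv sv]]] :=
  @indep_extend _ _ _ (part true) _ _ (famcat e0 u) s s0 iu.
exists k, l, (famcat (famcat e0 u) v); split.
  split=> //.
    by case=> [[[[]|[]]|i]|i] //=; case: (Wu i).
  move=> t; have [t0 [t1 [pt0 pt1 ->]]] := part_sum t.
  have sS := spanned_subspace (famcat (famcat e0 u) v) s0.
  have mem i := spanned_mem (famcat (famcat e0 u) v) i s0.
  apply: (subspaceD sS); last exact: sv.
  have [c ec] := Dz _ (derived_br t0 y).
  have [c' ec'] := Dz _ (derived_br t0 x).
  rewrite -/z in ec ec'.
  rewrite -[t0](subrK (c *: x)) -[t0 - _](addrK (c' *: y)).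
  apply: (subspaceD sS); last first.
    by apply: (subspaceZ _ sS); apply: (mem (inl (inl (inl true)))).
  apply: (subspaceB sS); last first.
    by apply: (subspaceZ _ sS); apply: (mem (inl (inl (inl false)))).
  (* The correction is dictated by [t0, y] = c z, [t0, x] = c' z and [x, y] = z. *)
  have W' : W (t0 - c *: x + c' *: y).
    have pW : part false (t0 - c *: x + c' *: y).
      have sp := @part_subspace _ L false.
      by apply: (subspaceD sp); [apply: (subspaceB sp)|] => //;
        apply: (subspaceZ _ sp).
    split=> //.
      apply: (brC_eq0 pW px).
      by rewrite brDl brBl !brZl xx yx ec' scaler0 subr0 scalerN subrr.
    apply: (brC_eq0 pW py).
    by rewrite brDl brBl !brZl yy ec subrr scaler0 addr0.
  apply: (spanned_min sS _ _ (su _ W')) => [w ->|i]; first by case: sS.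
  exact: (mem (inl i)).
have zr w : br w z = 0 by apply: centralr; apply: derived_br.
have zl w : br z w = 0 by apply: centrall; apply: derived_br.
have ux i : br (u i) x = 0 by case: (Wl _ (Wu i)).
have uy i : br (u i) y = 0 by case: (Wl _ (Wu i)).
have xu i : br x (u i) = 0 by case: (Wu i).
have yu i : br y (u i) = 0 by case: (Wu i).
have uu i j : br (u i) (u j) = 0 by apply: WW.
have vl i w : br (v i) w = 0 by apply: even_even; left; apply: pv.
have vr i w : br w (v i) = 0 by apply: even_even; right; apply: pv.
case=> [[[[]|[]]|i]|i] [[[[]|[]]|j]|j] /=;
  rewrite ?(zl, zr, ux, uy, xu, yu, uu, vl, vr, xx, yy, yx) ?subrr ?scale0r //.
  by rewrite subr0 scale1r.
by rewrite sub0r scaleN1r.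
Qed.

End Dichotomy.

(** * Lower bounds for the multiplier *)

Section CentralExtension.
Variables (K : numFieldType) (L : lieSuperalgebra K).

(** These are the identities that turn L + K, with the new line in degree [g], into a Lie
    superalgebra. *)
Record cocycle (g : bool) (beta : L -> L -> K) : Prop := Cocycle {
  cocycle_linearl : forall y, linear (beta^~ y : L -> K^o);
  cocycle_linearr : forall x, linear (beta x : L -> K^o);
  cocycle_graded : forall i j x y, part i x -> part j y ->
    i (+) j != g -> beta x y = 0;
  cocycle_skew : forall i j x y, part i x -> part j y ->
    beta x y = - ((-1) ^+ (i && j) * beta y x);
  cocycle_jacobi : forall i j x y z, part i x -> part j y ->
    beta x (br y z) = beta (br x y) z + (-1) ^+ (i && j) * beta y (br x z)
}.

Variables (g : bool) (beta : L -> L -> K).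
Hypothesis cb : cocycle g beta.

Definition cext_carrier : lmodType K := (L * K^o)%type.

Definition cext_part (i : bool) : set cext_carrier :=
  [set x | part i x.1 /\ (i != g -> x.2 = 0)].

Definition cext_br (x y : cext_carrier) : cext_carrier :=
  (br x.1 y.1, beta x.1 y.1).

Lemma cext_axioms : is_lie_superalgebra cext_part cext_br.
Proof.
have s i := @part_subspace K L i.
split.
- move=> i; split; first by split=> //; apply: subspace0.
  move=> a x y [x1 x2] [y1 y2]; split=> [|ig]; first exact: (s i).2.
  by rewrite /= x2 // y2 // scaler0 addr0.
- move=> [u t]; have [u0 [u1 [p0 p1 ->]]] := part_sum u.
  exists (u0, if g then 0 else t), (u1, if g then t else 0).
  rewrite /cext_part /=; split; [by split=> //; case: (g)..|].
  by congr pair; case: (g); rewrite /= ?addr0 ?add0r.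
- move=> [u t] [/= p0 t0] [/= p1 t1]; congr pair.
    exact: (@part_disjoint _ _ false).
  by case: (g) t0 t1 => [t0 _|_ t1]; [apply: t0|apply: t1].
- move=> y a u v; congr pair; rewrite /=; first by rewrite brDl brZl.
  exact: (cocycle_linearl cb).
- move=> x a u v; congr pair; rewrite /=; first by rewrite brDr brZr.
  exact: (cocycle_linearr cb).
- move=> i j x y [x1 _] [y1 _]; split=> /=; first exact: part_br.
  exact: (cocycle_graded cb).
- move=> i j x y [x1 _] [y1 _]; congr pair => /=; first exact: brC.
  exact: (cocycle_skew cb).
move=> i j x y z [x1 _] [y1 _]; congr pair => /=; first exact: br_jacobi.
exact: (cocycle_jacobi cb).
Qed.

Definition cext : lieSuperalgebra K := LieSuperalgebra cext_axioms.

(** Generators are lifted with second component 0; the uniqueness half of freeness then identifies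
    the first component with [fp_map P]. *)
Lemma cext_lift (P : free_presentation L) :
  exists2 h : {linear fp_alg P -> cext}, lie_hom h &
    forall u, (h u).1 = fp_map P u.
Proof.
pose f := fp_map P; have [inc_part univ] := fp_free P.
have hf : forall x, @part K cext (fp_deg x) (f (@fp_inc _ _ P x), 0 : K^o).
  by move=> x; split=> //=; apply: fp_part.
have [[h [hh hinc]] _] := univ cext _ hf; exists h => // u.
have lin1 : linear (fun u => (h u).1) by move=> a v w; rewrite linearP.
pose h1 : {linear fp_alg P -> L} :=
  HB.pack (fun u => (h u).1) (GRing.isLinear.Build _ _ _ _ _ lin1).
have [_ uniq1] := univ L (fun x => f (@fp_inc _ _ P x))
  (fun x => fp_part (inc_part x)).
apply: (uniq1 h1 f) => //.
- split=> [i v /hh.1[]//|v w].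
  by rewrite /h1 /= hh.2.
- exact: fp_hom.
by move=> x; rewrite /h1 /= hinc.
Qed.

(** The second component of the lift is a functional on F that takes [u, v] to the value of [beta]
    on the images, so it kills [F, R]. *)
Lemma cocycle_vanish (P : free_presentation L) (J : finType) (c : J -> K)
    (u v : J -> fp_alg P) :
  br_span setT (fp_rel P) (\sum_j c j *: br (u j) (v j)) ->
  \sum_j c j * beta (fp_map P (u j)) (fp_map P (v j)) = 0.
Proof.
have [h hh h1] := cext_lift P.
have hbr x y : (h (br x y)).2 = beta (fp_map P x) (fp_map P y).
  by rewrite hh.2 /= !h1.
have beta0 x : beta x 0 = 0.
  have := cocycle_linearr cb x 1 0 0; rewrite !scale1r addr0 => /eqP.
  by rewrite -subr_eq0 opprD addrA subrr sub0r oppr_eq0 => /eqP.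
have lin2 : linear (fun u => (h u).2 : K^o) by move=> a x y; rewrite linearP.
pose h2 : {linear fp_alg P -> K^o} :=
  HB.pack (fun u => (h u).2 : K^o) (GRing.isLinear.Build _ _ _ _ _ lin2).
have FRh : br_span setT (fp_rel P) `<=` [set x | h2 x = 0].
  apply: br_span_min => [|x y _ fy]; last by rewrite /= hbr fy beta0.
  split=> [|a x y hx hy]; first exact: (linear0 h2).
  have := linearP h2 a x y; rewrite (hx : h2 x = 0) (hy : h2 y = 0).
  by rewrite scaler0 addr0.
move=> /FRh h0; rewrite -[RHS](h0 : h2 _ = 0) linear_sum.
by apply: eq_bigr => j _; rewrite linearZ /= hbr.
Qed.

End CentralExtension.

Section LowerBound.
Variables (K : numFieldType) (L : lieSuperalgebra K).
Variables (P : free_presentation L) (d : nat).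
Hypothesis hd : multiplier_dim_of P d.

(** Up to nonzero scalars the cocycles are dual to the brackets of lifts of [a j] and [b j], which
    belong to R because these vectors have bracket 0. *)
Lemma multiplier_ge (J : finType) (a b : J -> L) (g : J -> bool)
    (beta : J -> L -> L -> K) :
  (forall j, br (a j) (b j) = 0) -> (forall j, cocycle (g j) (beta j)) ->
  (forall j k, (beta j (a k) (b k) == 0) = (j != k)) -> (#|J| <= d)%N.
Proof.
move=> ab0 cb bE; case: hd => e [_ _ se].
have [/choice[ta fa] /choice[tb fb]] : (forall j, exists u, fp_map P u = a j) /\
  (forall j, exists u, fp_map P u = b j) by split=> j; apply: fp_surj.
rewrite -[d]card_ord.
apply: (@steinitz _ _ (br_span setT (fp_rel P)) _ _
  (fun j => br (ta j) (tb j)) e); first exact: FR_subspace.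
- move=> c hc j; have := cocycle_vanish (cb j) hc.
  rewrite (bigD1 j) //= big1 ?addr0 => [|k kj].
    by rewrite fa fb => /eqP; rewrite mulf_eq0 bE eqxx orbF => /eqP.
  by apply/eqP; rewrite fa fb mulf_eq0 bE [j == k]eq_sym kj orbT.
move=> j; apply: se; split; first exact: br_span_mem.
by rewrite /fp_rel /= fp_br fa fb ab0.
Qed.

End LowerBound.

(** * Coordinate functionals and the cocycles they define *)

Section Coordinates.
Variables (K : numFieldType) (L : lieSuperalgebra K).
Variables (I : finType) (e : I -> L) (p : I -> bool).
Hypothesis he : hbasis e p.

Lemma hbasis_coord : exists co : I -> L -> K,
  [/\ forall v, v = \sum_i co i v *: e i, forall i, linear (co i : L -> K^o),
      forall i j, co i (e j) = (i == j)%:R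
    & forall i b v, part b v -> p i != b -> co i v = 0].
Proof.
have /choice[c cE] : forall v, exists c : I -> K, v = \sum_i c i *: e i.
  by move=> v; apply: hbasisE he.
have uniq (c1 c2 : I -> K) : \sum_i c1 i *: e i = \sum_i c2 i *: e i ->
    forall i, c1 i = c2 i.
  move=> e12 i; apply/eqP; rewrite -subr_eq0; apply/eqP.
  apply: (hbasis_indep he (c := fun i => c1 i - c2 i)) => /=.
  by under eq_bigr do rewrite scalerBl; rewrite big_split /= sumrN e12 subrr.
exists (fun i v => c v i); split=> //.
- move=> i a u v; apply: (uniq _ (fun i => a * c u i + c v i)); rewrite -cE.
  under eq_bigr do rewrite scalerDl -scalerA.
  by rewrite big_split /= -scaler_sumr -!cE.
- move=> i j; rewrite eq_sym.
  apply: (uniq _ (fun i => (j == i)%:R)); rewrite -cE.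
  rewrite (bigD1 j) //= eqxx scale1r big1 ?addr0 // => k kj.
  by rewrite eq_sym (negPf kj) scale0r.
move=> i b v pv pi.
have sb := @part_subspace K L b; have sb' := @part_subspace K L (~~ b).
have pb' j : p j != b -> p j = ~~ b by case: (p j) (b) => -[].
have s0 : \sum_(j | p j != b) c v j *: e j = 0.
  apply: (@part_disjoint _ _ b).
    rewrite [X in part _ X](_ : _ = v - \sum_(j | p j == b) c v j *: e j).
      apply: (subspaceB sb pv); apply: (subspace_sum _ sb) => j /eqP <-.
      by apply: subspaceZ; [exact: part_subspace|exact: hbasis_part he _].
    apply/eqP; rewrite eq_sym subr_eq addrC; apply/eqP.
    by rewrite [LHS]cE [LHS](bigID (fun j => p j == b)).
  apply: (subspace_sum _ sb') => j /pb' <-.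
  by apply: subspaceZ; [exact: part_subspace|exact: hbasis_part he _].
have := hbasis_indep he (c := fun j => if p j != b then c v j else 0).
move=> /(_ _ i); rewrite pi; apply; rewrite /= -[RHS]s0 [RHS]big_mkcond.
by apply: eq_bigr => j _; case: ifP; rewrite ?scale0r.
Qed.

Variable co : I -> L -> K.
Hypotheses (co_lin : forall i, linear (co i : L -> K^o))
  (co_e : forall i j, co i (e j) = (i == j)%:R)
  (co_part : forall i b v, part b v -> p i != b -> co i v = 0).

(** The graded wedge of two coordinate functionals; for a = b it is 0 if the index is even and twice
    a square if it is odd. *)
Definition pair_form (a b : I) (v w : L) : K :=
  co a v * co b w - (-1) ^+ (p a && p b) * (co b v * co a w).

(** Duality with the exterior pairs. The premise excludes a = b even, where the form is 0; for a = b
    odd the value 2 is nonzero in characteristic 0. *)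
Lemma pair_form_eq0 a b a' b' : (a == b -> p a) ->
  (pair_form a b (e a') (e b') == 0) =
  ([set a; b]%SET != [set a'; b']%SET).
Proof.
move=> pab; rewrite /pair_form !co_e.
have [ab|nab] := eqVneq a b.
  subst b; rewrite pab // /= expr1 mulN1r opprK -mulr2n mulrn_eq0 /=.
  rewrite mulf_eq0 !pnatr_eq0 !eqb0.
  apply/idP/idP => [|].
    by apply: contraTneq => /set2_eqP[[-> ->]|[-> ->]]; rewrite !eqxx.
  rewrite -negb_and; apply: contraNN => /andP[/eqP -> /eqP ->].
  by [].
case: (eqVneq a a') => [<-|aa'].
  rewrite mul1r (eq_sym b a) (negPf nab) mul0r mulr0 subr0 pnatr_eq0 eqb0.
  apply/idP/idP; first by apply: contraNN => /eqP/set2_eqP[[_ ->]|[_ /esym]] //;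
    move=> h; move: nab; rewrite h eqxx.
  by apply: contraNN => /eqP ->.
rewrite mul0r sub0r oppr_eq0 mulf_eq0 signr_eq0 /= mulf_eq0 !pnatr_eq0 !eqb0.
rewrite -negb_and; congr (~~ _); apply/andP/eqP => [[/eqP -> /eqP ->]|].
  by rewrite finset.setUC.
by move=> /set2_eqP[[h _]|[-> ->]]; [rewrite h eqxx in aa'|rewrite !eqxx].
Qed.

(** Only the Jacobi condition involves the bracket of [L]; bilinearity, degree and symmetry are
    formal. *)
Lemma pair_form_cocycle a b :
  (forall i j x y z, part i x -> part j y -> pair_form a b x (br y z) =
    pair_form a b (br x y) z + (-1) ^+ (i && j) * pair_form a b y (br x z)) ->
  cocycle (p a (+) p b) (pair_form a b).
Proof.
move=> jac; split=> //.
- move=> y c u v; rewrite /pair_form !co_lin -![c *: _]/(c * _); ring.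
- move=> x c u v; rewrite /pair_form !co_lin -![c *: _]/(c * _); ring.
- move=> i j x y px py ij; rewrite /pair_form.
  have [ai|ai] := eqVneq (p a) i; have [bj|bj] := eqVneq (p b) j.
  + by move: ij; rewrite -ai -bj eqxx.
  + rewrite (co_part py bj) mulr0 sub0r.
    have [bi|bi] := eqVneq (p b) i; last by
      rewrite (co_part px bi) mul0r mulr0 oppr0.
    have [aj|aj] := eqVneq (p a) j; last by
      rewrite (co_part py aj) !mulr0 oppr0.
    by move: ij; rewrite -bi -aj addbC eqxx.
  + rewrite (co_part px ai) mul0r sub0r.
    have [bi|bi] := eqVneq (p b) i; last by
      rewrite (co_part px bi) mul0r mulr0 oppr0.
    have [aj|aj] := eqVneq (p a) j; last by
      rewrite (co_part py aj) !mulr0 oppr0.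
    by move: ij; rewrite -bi -aj addbC eqxx.
  rewrite (co_part px ai) mul0r sub0r.
  have [bi|bi] := eqVneq (p b) i; last by
    rewrite (co_part px bi) mul0r mulr0 oppr0.
  have [aj|aj] := eqVneq (p a) j; last by
    rewrite (co_part py aj) !mulr0 oppr0.
  by move: ij; rewrite -bi -aj addbC eqxx.
move=> i j x y px py; rewrite /pair_form.
(* Coordinates vanish off their own parity, so the sign of the arguments can be traded for the sign
   of the indices. *)
have sgn a' b' : (-1) ^+ (i && j) * (co a' x * co b' y) =
    (-1) ^+ (p a' && p b') * (co a' x * co b' y).
  have [ai|ai] := eqVneq (p a') i; last by rewrite (co_part px ai) mul0r !mulr0.
  have [bj|bj] := eqVneq (p b') j; last by rewrite (co_part py bj) !mulr0.
  by rewrite ai bj.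
have s2 : (-1) ^+ (p a && p b) * (-1) ^+ (p a && p b) = 1 :> K.
  by rewrite -expr2 sqrr_sign.
set t := (-1) ^+ (i && j) in sgn *; set s := (-1) ^+ (p a && p b) in s2 *.
have -> : - (t * (co a y * co b x - s * (co b y * co a x))) =
    - (t * (co b x * co a y)) + s * (t * (co a x * co b y)) by ring.
by rewrite (sgn b a) (sgn a b) andbC -/s mulrA s2 mul1r addrC.
Qed.

Lemma pair_form_cocycle0 a b : (forall x y, co a (br x y) = 0) ->
  (forall x y, co b (br x y) = 0) -> cocycle (p a (+) p b) (pair_form a b).
Proof.
move=> a0 b0; apply: pair_form_cocycle => i j x y z _ _.
by rewrite /pair_form !a0 !b0 !(mulr0, mul0r) subrr mulr0 addr0.
Qed.

(** The hypothesis covers both orders of a pair, because the ordered representatives [ab] are chosen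
    arbitrarily. *)
Lemma multiplier_ge_pairs (P : free_presentation L) d (S : {set {set I}}) :
  multiplier_dim_of P d -> S \subset exterior_pairs p ->
  (forall i j, [set i; j]%SET \in S -> br (e i) (e j) = 0 /\
     cocycle (p i (+) p j) (pair_form i j)) ->
  (#|S| <= d)%N.
Proof.
move=> hd /fintype.subsetP SO hS; rewrite -(card_sig (fun A => A \in S)).
have /choice[ab hab] : forall A : {A | A \in S},
    exists q : I * I, val A = [set q.1; q.2]%SET.
  by move=> [A] /= /SO /exterior_pairs_ex[i [j ->]]; exists (i, j).
have inS A : [set (ab A).1; (ab A).2]%SET \in S by rewrite -hab; apply: valP.
have odd A : (ab A).1 == (ab A).2 -> p (ab A).1.
  by move=> eqA; have /SO := inS A; rewrite exterior_pairsE eqA.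
apply: (multiplier_ge hd (a := fun A => e (ab A).1) (b := fun A => e (ab A).2)
  (g := fun A => p (ab A).1 (+) p (ab A).2)
  (beta := fun A => pair_form (ab A).1 (ab A).2)).
- by move=> A; case: (hS _ _ (inS A)).
- by move=> A; case: (hS _ _ (inS A)).
move=> A B; rewrite pair_form_eq0; last exact: odd.
by rewrite -!hab -val_eqE.
Qed.

End Coordinates.

(** * Existence of free presentations *)

Section FreeLieSuperalgebra.
Local Open Scope quotient_scope.
Variables (K : numFieldType) (X : Type) (deg : X -> bool).

Inductive fterm : Type :=
  | FVar of X
  | FZero
  | FAdd of fterm & fterm
  | FScale of K & fterm
  | FBr of fterm & fterm.

HB.instance Definition _ := gen_eqMixin fterm.
HB.instance Definition _ := gen_choiceMixin fterm.

Fixpoint feval (M : lieSuperalgebra K) (f : X -> M) (t : fterm) : M :=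
  match t with
  | FVar x => f x
  | FZero => 0
  | FAdd s t => feval f s + feval f t
  | FScale a t => a *: feval f t
  | FBr s t => br (feval f s) (feval f t)
  end.

(** Homogeneous components are computed on terms, which is what decomposes a class of the quotient
    into an even and an odd part. *)
Fixpoint fproj (i : bool) (t : fterm) : fterm :=
  match t with
  | FVar x => if deg x == i then FVar x else FZero
  | FZero => FZero
  | FAdd s t => FAdd (fproj i s) (fproj i t)
  | FScale a t => FScale a (fproj i t)
  | FBr s t => FAdd (FBr (fproj false s) (fproj i t))
                    (FBr (fproj true s) (fproj (~~ i) t))
  end.

Lemma feval_proj (M : lieSuperalgebra K) (f : X -> M) t :
  (forall x, part (deg x) (f x)) ->
  (forall i, part i (feval f (fproj i t))) /\
  feval f t = feval f (fproj false t) + feval f (fproj true t).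
Proof.
move=> fdeg; elim: t => [x||s [ps es] t [pt et]|a t [pt et]|s [ps es] t [pt et]] /=.
- split=> [i|]; first by case: eqVneq => [<-|_] //=; apply: part0.
  by case: (deg x); rewrite /= ?addr0 ?add0r.
- by split=> [i|]; [apply: part0|rewrite addr0].
- split=> [i|]; first by apply: subspaceD => //; apply: part_subspace.
  by rewrite {1}es {1}et addrACA.
- split=> [i|]; first by apply: subspaceZ => //; apply: part_subspace.
  by rewrite {1}et scalerDr.
split=> [i|]; last by rewrite {1}es {1}et brDl !brDr [RHS]addrACA [X in _ + X]addrC.
apply: subspaceD; first exact: part_subspace.
  exact: (part_br (ps false) (pt i)).
by have := part_br (ps true) (pt (~~ i)); rewrite addTb negbK.
Qed.

(* Two terms are identified when they agree in every Lie superalgebra, so that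
   all the axioms hold in the quotient because they hold everywhere. *)
Definition feqv (s t : fterm) : bool :=
  `[< forall (M : lieSuperalgebra K) (f : X -> M),
      (forall x, part (deg x) (f x)) -> feval f s = feval f t >].

Lemma feqv_equiv : equiv_class_of feqv.
Proof.
split=> [t|s t|t s u]; first exact/asboolP.
  by apply/asboolP/asboolP => h M f hf; rewrite h.
move=> /asboolP h1 /asboolP h2; apply/asboolP => M f hf.
by rewrite h1 // h2.
Qed.

Canonical feqv_rel := EquivRelPack feqv_equiv.

Definition flie := {eq_quot feqv_rel}.
HB.instance Definition _ := Choice.on flie.

Definition fcls (t : fterm) : flie := \pi_flie t.

Definition qeval (M : lieSuperalgebra K) (f : X -> M) (q : flie) : M :=
  feval f (repr q).

Lemma qeval_cls (M : lieSuperalgebra K) (f : X -> M) t :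
  (forall x, part (deg x) (f x)) -> qeval f (fcls t) = feval f t.
Proof.
move=> hf; rewrite /qeval /fcls.
by have /eqmodP/asboolP := reprK (fcls t); apply.
Qed.

Lemma flie_ext (q q' : flie) :
  (forall (M : lieSuperalgebra K) (f : X -> M),
     (forall x, part (deg x) (f x)) -> qeval f q = qeval f q') -> q = q'.
Proof.
move=> h; rewrite -[q]reprK -[q']reprK; apply/eqmodP/asboolP => M f hf.
exact: h.
Qed.

Definition fadd (q q' : flie) := fcls (FAdd (repr q) (repr q')).
Definition fopp (q : flie) := fcls (FScale (-1) (repr q)).
Definition fscale (a : K) (q : flie) := fcls (FScale a (repr q)).
Definition fbr (q q' : flie) := fcls (FBr (repr q) (repr q')).

Section QuotientEval.
Variables (M : lieSuperalgebra K) (f : X -> M).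
Hypothesis hf : forall x, part (deg x) (f x).

Lemma qeval_add q q' : qeval f (fadd q q') = qeval f q + qeval f q'.
Proof. exact: qeval_cls. Qed.

Lemma qeval_scale a q : qeval f (fscale a q) = a *: qeval f q.
Proof. exact: qeval_cls. Qed.

Lemma qeval_opp q : qeval f (fopp q) = - qeval f q.
Proof. by rewrite -scaleN1r -qeval_scale. Qed.

Lemma qeval_zero : qeval f (fcls FZero) = 0.
Proof. exact: qeval_cls. Qed.

Lemma qeval_br q q' : qeval f (fbr q q') = br (qeval f q) (qeval f q').
Proof. exact: qeval_cls. Qed.

End QuotientEval.

Lemma faddA : associative fadd.
Proof.
by move=> a b c; apply: flie_ext => M f hf; rewrite !qeval_add // addrA.
Qed.

Lemma faddC : commutative fadd.
Proof. by move=> a b; apply: flie_ext => M f hf; rewrite !qeval_add // addrC. Qed.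

Lemma fadd0 : left_id (fcls FZero) fadd.
Proof.
by move=> a; apply: flie_ext => M f hf; rewrite qeval_add // qeval_zero // add0r.
Qed.

Lemma faddN : left_inverse (fcls FZero) fopp fadd.
Proof.
move=> a; apply: flie_ext => M f hf.
by rewrite qeval_add // qeval_opp // qeval_zero // addNr.
Qed.

HB.instance Definition _ :=
  GRing.isZmodule.Build flie faddA faddC fadd0 faddN.

Lemma qevalD (M : lieSuperalgebra K) (f : X -> M) q q' :
  (forall x, part (deg x) (f x)) -> qeval f (q + q') = qeval f q + qeval f q'.
Proof. by move=> hf; apply: qeval_cls. Qed.

Lemma fscaleA a b q : fscale a (fscale b q) = fscale (a * b) q.
Proof.
by apply: flie_ext => M f hf; rewrite !qeval_scale // scalerA.
Qed.

Lemma fscale1 : left_id 1 fscale.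
Proof. by move=> q; apply: flie_ext => M f hf; rewrite qeval_scale // scale1r. Qed.

Lemma fscaleDr : right_distributive fscale +%R.
Proof.
move=> a q q'; apply: flie_ext => M f hf.
by rewrite qevalD // !qeval_scale // qevalD // scalerDr.
Qed.

Lemma fscaleDl q : {morph fscale^~ q : a b / a + b}.
Proof.
move=> a b; apply: flie_ext => M f hf.
by rewrite qevalD // !qeval_scale // scalerDl.
Qed.

HB.instance Definition _ :=
  GRing.Zmodule_isLmodule.Build K flie fscaleA fscale1 fscaleDr fscaleDl.

Lemma qevalZ (M : lieSuperalgebra K) (f : X -> M) a q :
  (forall x, part (deg x) (f x)) -> qeval f (a *: q) = a *: qeval f q.
Proof. by move=> hf; apply: qeval_cls. Qed.

Lemma qeval0 (M : lieSuperalgebra K) (f : X -> M) :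
  (forall x, part (deg x) (f x)) -> qeval f 0 = 0.
Proof. by move=> hf; apply: qeval_cls. Qed.

Definition fpart (i : bool) : set flie :=
  [set q | forall (M : lieSuperalgebra K) (f : X -> M),
     (forall x, part (deg x) (f x)) -> part i (qeval f q)].

Lemma flie_axioms : is_lie_superalgebra fpart fbr.
Proof.
split.
- move=> i; split=> [M f hf|a x y px py M f hf].
    by rewrite qeval0 //; apply: part0.
  rewrite qevalD // qevalZ //; apply: (@part_subspace _ _ _).2.
    exact: px.
  exact: py.
- move=> q; exists (fcls (fproj false (repr q))), (fcls (fproj true (repr q))).
  split.
  + by move=> M f hf; rewrite qeval_cls //; case: (feval_proj (repr q) hf).
  + by move=> M f hf; rewrite qeval_cls //; case: (feval_proj (repr q) hf).
  apply: flie_ext => M f hf; rewrite qevalD // !qeval_cls //.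
  by case: (feval_proj (repr q) hf).
- move=> x p0 p1; apply: flie_ext => M f hf; rewrite qeval0 //.
  by apply: (@part_disjoint _ _ false); [apply: p0|apply: p1].
- move=> y a u v; apply: flie_ext => M f hf.
  by rewrite qevalD // qevalZ // !qeval_br // qevalD // qevalZ // brDl brZl.
- move=> y a u v; apply: flie_ext => M f hf.
  by rewrite qevalD // qevalZ // !qeval_br // qevalD // qevalZ // brDr brZr.
- move=> i j x y px py M f hf; rewrite qeval_br //.
  by apply: part_br; [apply: px|apply: py].
- move=> i j x y px py; apply: flie_ext => M f hf.
  rewrite -scaleN1r !(qevalZ, qeval_br) // scaleN1r.
  by apply: brC; [apply: px|apply: py].
move=> i j x y z px py; apply: flie_ext => M f hf.
rewrite !(qevalD, qevalZ, qeval_br) //.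
by apply: br_jacobi; [apply: px|apply: py].
Qed.

Definition free_lie : lieSuperalgebra K := LieSuperalgebra flie_axioms.

Definition free_inc (x : X) : free_lie := fcls (FVar x).

Lemma fcls_add s t : fcls (FAdd s t) = fcls s + fcls t.
Proof. by apply: flie_ext => M f hf; rewrite qevalD // !qeval_cls. Qed.

Lemma fcls_scale a t : fcls (FScale a t) = a *: fcls t.
Proof. by apply: flie_ext => M f hf; rewrite qevalZ // !qeval_cls. Qed.

Lemma fcls_br s t : fcls (FBr s t) = fbr (fcls s) (fcls t).
Proof. by apply: flie_ext => M f hf; rewrite qeval_br // !qeval_cls. Qed.

(** Existence is evaluation of terms; uniqueness is an induction on a term representing the
    class. *)
Lemma free_lie_free : free_on deg free_inc.
Proof.
split=> [x M f hf|M f hf]; first by rewrite qeval_cls.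
split.
  have lin : linear (qeval f : free_lie -> M).
    by move=> a u v; rewrite qevalD // qevalZ.
  pose g : {linear free_lie -> M} :=
    HB.pack (qeval f : free_lie -> M) (GRing.isLinear.Build _ _ _ _ _ lin).
  exists g; split; last first.
    by move=> x; apply: qeval_cls.
  split=> [i x px|x y]; first exact: px.
  exact: qeval_br.
move=> g h hg hh gx hx u; rewrite -[u]reprK -/(fcls _).
elim: (repr u) => [x||s IHs t IHt|a t IHt|s IHs t IHt].
- by rewrite [LHS]gx [RHS]hx.
- by rewrite (_ : fcls FZero = 0) // !linear0.
- by rewrite fcls_add !linearD IHs IHt.
- by rewrite fcls_scale !linearZ IHt.
by rewrite fcls_br; rewrite [LHS]hg.2 [RHS]hh.2 IHs IHt.
Qed.

End FreeLieSuperalgebra.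

(** The generators are all homogeneous elements tagged with a degree, so 0 occurs once in each
    degree. *)
Lemma free_presentation_exists (K : numFieldType) (L : lieSuperalgebra K) :
  inhabited (free_presentation L).
Proof.
pose X := {x : bool * L | part x.1 x.2}.
pose deg (x : X) := (sval x).1; pose inc (x : X) := (sval x).2.
have hinc x : part (deg x) (inc x) by apply: svalP x.
have [[g [hg gx]] _] := (free_lie_free K deg).2 L inc hinc.
split; apply: (@FreePresentation _ L X deg _ _ (free_lie_free K deg) g hg) => y.
have [y0 [y1 [p0 p1 ->]]] := part_sum y.
pose x0 : X := exist (fun x => part x.1 x.2) (false, y0) p0.
pose x1 : X := exist (fun x => part x.1 x.2) (true, y1) p1.
by exists (free_inc K deg x0 + free_inc K deg x1); rewrite linearD !gx.
Qed.

(** * Classification *)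

Section Isomorphisms.
Variable K : numFieldType.
Implicit Types L M : lieSuperalgebra K.

(** The inverse is even: if the image of x0 + x1 is homogeneous, the component of the wrong parity
    has image 0, hence is 0 by injectivity. *)
Lemma isomorphic_sym L M : isomorphic L M -> isomorphic M L.
Proof.
move=> [f [[fpart fbr] [g fK gK]]].
have lin : linear g.
  by move=> a x y; apply: (can_inj fK); rewrite linearP !gK.
pose g' : {linear M -> L} := HB.pack g (GRing.isLinear.Build _ _ _ _ _ lin).
exists g'; split; last by exists f.
split=> [i y py|x y]; last by apply: (can_inj fK); rewrite fbr !gK.
change (part i (g y)); have [x0 [x1 [p0 p1 e]]] := part_sum (g y).
have : part i (f x0 + f x1) by rewrite -linearD -e gK.
move=> /(graded_part (fpart _ _ p0) (fpart _ _ p1))[q0 q1].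
have inj0 x : f x = 0 -> x = 0.
  by move=> fx; apply: (can_inj fK); rewrite fx linear0.
rewrite e; case: i py q0 q1 => _ q0 q1.
  rewrite (inj0 x0) ?add0r //.
  by apply: (@part_disjoint _ _ true) => //; apply: fpart.
rewrite (inj0 x1) ?addr0 //.
by apply: (@part_disjoint _ _ false) => //; apply: fpart.
Qed.

Lemma hbasis_map L M (f : {linear L -> M}) (I : finType) (e : I -> L) p :
  lie_hom f -> bijective f -> hbasis e p -> hbasis (f \o e) p.
Proof.
move=> [fpart fbr] [g fK gK] he; split.
- by move=> i; apply: fpart; apply: hbasis_part he i.
- move=> c h; apply: (hbasis_indep he); apply: (can_inj fK).
  rewrite linear0 -[RHS](h : _ = 0) linear_sum.
  by apply: eq_bigr => i _; rewrite linearZ.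
move=> y; have [c ec] := hbasisE (g y) he; exists c => /=.
rewrite -[y]gK ec linear_sum; apply/eqP; rewrite subr_eq0; apply/eqP.
by apply: eq_bigr => i _; rewrite linearZ.
Qed.

Lemma hbasis_isomorphic L M (I : finType) (e : I -> L) (e' : I -> M) p
    (c : I -> I -> I -> K) :
  hbasis e p -> hbasis e' p ->
  (forall i j, br (e i) (e j) = \sum_k c i j k *: e k) ->
  (forall i j, br (e' i) (e' j) = \sum_k c i j k *: e' k) ->
  isomorphic L M.
Proof.
move=> he he' ce ce'.
have [co [coE co_lin co_e co_part]] := hbasis_coord he.
have [co' [coE' co_lin' co_e' _]] := hbasis_coord he'.
pose f0 v := \sum_i co i v *: e' i; pose g0 w := \sum_i co' i w *: e i.
have f0lin : linear f0.
  move=> a u v; rewrite /f0 scaler_sumr -big_split; apply: eq_bigr => i _ /=.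
  by rewrite co_lin scalerDl scalerA.
have g0lin : linear g0.
  move=> a u v; rewrite /g0 scaler_sumr -big_split; apply: eq_bigr => i _ /=.
  by rewrite co_lin' scalerDl scalerA.
pose f : {linear L -> M} := HB.pack f0 (GRing.isLinear.Build _ _ _ _ _ f0lin).
pose g : {linear M -> L} := HB.pack g0 (GRing.isLinear.Build _ _ _ _ _ g0lin).
have fe i : f (e i) = e' i.
  rewrite /f /= /f0 (bigD1 i) //= co_e eqxx scale1r big1 ?addr0 // => j ji.
  by rewrite co_e (negPf ji) scale0r.
have ge i : g (e' i) = e i.
  rewrite /g /= /g0 (bigD1 i) //= co_e' eqxx scale1r big1 ?addr0 // => j ji.
  by rewrite co_e' (negPf ji) scale0r.
have fK : cancel f g.
  apply: (hbasis_ext (T := [set v | g (f v) = v]) he) => [|i]; last first.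
    by rewrite /mkset fe ge.
  split=> [|a u v hu hv]; first by rewrite /mkset !linear0.
  by rewrite /mkset !linearP (hu : g (f u) = u) (hv : g (f v) = v).
have gK : cancel g f.
  apply: (hbasis_ext (T := [set v | f (g v) = v]) he') => [|i]; last first.
    by rewrite /mkset ge fe.
  split=> [|a u v hu hv]; first by rewrite /mkset !linear0.
  by rewrite /mkset !linearP (hu : f (g u) = u) (hv : f (g v) = v).
exists f; split; last by exists g.
split.
  move=> b v pv; apply: subspace_sum => [|i _]; first exact: part_subspace.
  have [<-|ib] := eqVneq (p i) b; last first.
    by rewrite (co_part _ _ _ pv ib) scale0r; apply: part0.
  by apply: subspaceZ; [exact: part_subspace|exact: hbasis_part he' _].
move=> x y; pose T y := [set x | f (br x y) = br (f x) (f y)].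
have sT z : subspace (T z).
  split=> [|a u v hu hv]; first by rewrite /T /mkset br0l !linear0 br0l.
  rewrite /T /mkset brDl brZl !linearP brDl brZl.
  by rewrite (hu : f (br u z) = _) (hv : f (br v z) = _).
apply: (hbasis_ext he (sT y) _ x) => i.
pose T' := [set y | f (br (e i) y) = br (f (e i)) (f y)].
have sT' : subspace T'.
  split=> [|a u v hu hv]; first by rewrite /T' /mkset br0r !linear0 br0r.
  rewrite /T' /mkset brDr brZr !linearP brDr brZr.
  by rewrite (hu : f (br _ u) = _) (hv : f (br _ v) = _).
apply: (hbasis_ext he sT' _ y) => j.
rewrite /T' /mkset ce linear_sum !fe ce'.
by apply: eq_bigr => k _; rewrite linearZ fe.
Qed.

Lemma isomorphic_hbasis L M (I : finType) (e' : I -> M) p :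
  isomorphic L M -> hbasis e' p -> exists2 f : {linear M -> L},
    lie_hom f & hbasis (f \o e') p.
Proof.
move=> /isomorphic_sym[f [hf bf]] he'; exists f => //.
exact: hbasis_map.
Qed.

End Isomorphisms.

(** * Explicit bases of the model superalgebras *)

Section Models.
Variable K : numFieldType.

Lemma sum_pair (U V : lmodType K) (I : finType) (F : I -> U * V) :
  \sum_i F i = (\sum_i (F i).1, \sum_i (F i).2).
Proof.
rewrite [LHS]surjective_pairing; congr pair.
  exact: (big_morph (fun x : U * V => x.1)).
exact: (big_morph (fun x : U * V => x.2)).
Qed.

Lemma sum_delta k (c : 'I_k -> K) :
  \sum_i c i *: delta_mx 0 i = \row_i c i :> 'rV_k.
Proof. by rewrite [RHS]row_sum_delta; apply: eq_bigr => i _; rewrite mxE. Qed.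

Lemma sum_scale0 (U : lmodType K) (I : finType) (c : I -> K) :
  \sum_i c i *: (0 : U) = 0.
Proof. by apply: big1 => i _; rewrite scaler0. Qed.

Lemma sum_pairl (U V : lmodType K) (I : finType) (c : I -> K) (u : I -> U) :
  \sum_i c i *: ((u i, 0) : U * V) = (\sum_i c i *: u i, 0).
Proof. by rewrite sum_pair /= sum_scale0. Qed.

Lemma sum_pairr (U V : lmodType K) (I : finType) (c : I -> K) (v : I -> V) :
  \sum_i c i *: ((0, v i) : U * V) = (0, \sum_i c i *: v i).
Proof. by rewrite sum_pair /= sum_scale0. Qed.

Variables k l : nat.

Definition abelian_fam : 'I_k + 'I_l -> abelian K k l :=
  famcat (fun i => (delta_mx 0 i, 0)) (fun j => (0, delta_mx 0 j)).

Lemma abelian_famE (c : 'I_k + 'I_l -> K) :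
  \sum_i c i *: abelian_fam i = (\row_i c (inl i), \row_j c (inr j)).
Proof.
rewrite sum_famcat !sum_pair /= !sum_scale0 !sum_delta.
by congr pair; rewrite /= ?addr0 ?add0r.
Qed.

Lemma abelian_fam_hbasis : hbasis abelian_fam (@famparity _ _).
Proof.
split.
- by case=> i.
- move=> c; rewrite abelian_famE => -[h1 h2] [] i.
    by have := congr1 (fun r : 'rV_k => r 0 i) h1; rewrite !mxE.
  by have := congr1 (fun r : 'rV_l => r 0 i) h2; rewrite !mxE.
move=> [u v]; exists (famcat (fun i => u 0 i) (fun j => v 0 j)).
rewrite abelian_famE /=; apply/eqP; rewrite subr_eq0; apply/eqP.
by congr pair; apply/rowP => i; rewrite !mxE.
Qed.

(** [true] is x_1, [false] is x_2 and the unit is z; for p = 1 the rows have length 1, whence the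
    constant matrices. *)
Definition heis3_fam (i : bool + unit) : heisenberg K 1 0 :=
  match i with
  | inl b => (const_mx b%:R, const_mx (~~ b)%:R, 0, 0)
  | inr _ => (0, 0, 1, 0)
  end.

Lemma heis3_famE (c : bool + unit -> K) :
  \sum_i c i *: heis3_fam i =
  (const_mx (c (inl true)), const_mx (c (inl false)), c (inr tt), 0).
Proof.
rewrite big_sumType big_bool (big_pred1 tt) => [|[] //].
congr (_, _, _, _); rewrite /=; last by rewrite !scaler0 !addr0.
- by apply/rowP => i; rewrite !mxE mulr1 !mulr0 !addr0.
- by apply/rowP => i; rewrite !mxE mulr1 !mulr0 add0r addr0.
by rewrite !scaler0 !add0r -[_ *: _]/(_ * _) mulr1.
Qed.

Definition heis_fam :
    ((bool + unit) + 'I_k) + 'I_l -> dsum (heisenberg K 1 0) (abelian K k l) :=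
  famcat (famcat (fun i => (heis3_fam i, 0)) (fun i => (0, abelian_fam (inl i))))
    (fun j => (0, abelian_fam (inr j))).

Lemma heis_famE (c : ((bool + unit) + 'I_k) + 'I_l -> K) :
  \sum_i c i *: heis_fam i =
  ((const_mx (c (inl (inl (inl true)))), const_mx (c (inl (inl (inl false)))),
    c (inl (inl (inr tt))), 0),
   (\row_i c (inl (inr i)), \row_j c (inr j))).
Proof.
pose c1 := famcat (fun i => c (inl (inr i))) (fun j => c (inr j)).
rewrite -(abelian_famE c1) -(heis3_famE (fun i => c (inl (inl i)))).
rewrite /heis_fam !sum_famcat sum_pairl !sum_pairr.
by congr pair; rewrite /= ?addr0 ?add0r // big_sumType.
Qed.

Lemma heis_fam_basis : heis_basis heis_fam.
Proof.
split.
  split.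
  - by case=> [[[[]|[]]|i]|i] /=; split=> //=; congr (_, _, _); apply/rowP => j;
      rewrite !mxE.
  - move=> c; rewrite heis_famE => -[h1 h2 h3 h4 h5] [[[[]|[]]|i]|i] //.
    + by have := congr1 (fun r : 'rV_1 => r 0 0) h1; rewrite !mxE.
    + by have := congr1 (fun r : 'rV_1 => r 0 0) h2; rewrite !mxE.
    + by have := congr1 (fun r : 'rV_k => r 0 i) h4; rewrite !mxE.
    by have := congr1 (fun r : 'rV_l => r 0 i) h5; rewrite !mxE.
  move=> [[[[u v] t] w] [r s]].
  exists (famcat (famcat (famcat (fun b : bool => if b then u 0 0 else v 0 0)
    (fun=> t)) (fun i => r 0 i)) (fun j => s 0 j)).
  rewrite heis_famE /=; apply/eqP; rewrite subr_eq0; apply/eqP.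
  congr (_, _, _, _, (_, _)); apply/rowP => i; rewrite !mxE ?ord1 //.
  by case: i.
have heis3_br i j : br (heis3_fam i) (heis3_fam j) =
    match i, j with inl b, inl b' => b%:R - b'%:R | _, _ => 0 end *:
    heis3_fam (inr tt).
  rewrite /= /heisenberg_br /heisenberg_form !big_ord1 big_ord0 addr0.
  congr (_, _, _, _); rewrite ?scaler0 // -[RHS]/(_ * _) mulr1.
  by case: i j => [[]|[]] [[]|[]]; rewrite /= !mxE ?(mulr0, mulr1, mul0r) ?subrr.
have brH0 (x : heisenberg K 1 0) : br x 0 = 0 /\ br 0 x = 0.
  by rewrite br0l br0r.
move=> i j; rewrite -[RHS]/((heis_const K i j *: heis3_fam (inr tt),
  heis_const K i j *: 0)) scaler0.
case: i => [[i|i]|i]; case: j => [[j|j]|j];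
  rewrite -[LHS]/(br (heis_fam _).1 (heis_fam _).1, 0);
  congr pair; rewrite /= ?scale0r; do ?exact: (brH0 _).2.
- exact: heis3_br.
- by case: i => [b|[]]; rewrite scale0r; apply: (brH0 _).1.
by case: i => [b|[]]; rewrite scale0r; apply: (brH0 _).1.
Qed.

End Models.

(** * Exact dimensions of the multipliers *)

Section MultiplierDim.
Variables (K : numFieldType) (L : lieSuperalgebra K) (m n : nat).
Hypothesis dimL : superdim L m n.

(** A presentation exists, and the brackets of lifts of pairs of basis vectors span [F, F] modulo
    [F, R], so [xget] does not fall back on 0. *)
Lemma multiplier_dimP :
  exists P : free_presentation L, multiplier_dim_of P (multiplier_dim L).
Proof.
apply: (@xgetPex _ 0%N [set d | exists P : free_presentation L,
  multiplier_dim_of P d]).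
have [P] := free_presentation_exists L.
have [e he] := superdim_hbasis dimL.
have /choice[te fe] : forall i, exists u, fp_map P u = e i.
  by move=> i; apply: fp_surj.
pose s (q : ('I_m + 'I_n) * ('I_m + 'I_n)) := br (te q.1) (te q.2).
have sB := @FR_subspace _ _ P; have sS := spanned_subspace s sB.
have BS := @sub_spanned _ _ (br_span setT (fp_rel P)) _ s.
have th := jacobi_closed_hbasis he (lifted_in_jacobi sS BS).
have [|d hd] := @quotient_dim_exists _ _
  (br_span setT setT `&` fp_rel P) _ _ s sB; last by exists d, P.
move=> u [Du _]; move: u Du; apply: br_span_min => // u v _ _.
apply: th (erefl _) (erefl _) => i j; rewrite -!fe.
apply: (lifted_inE sS BS); exact: (spanned_mem s (i, j) sB).
Qed.

Lemma hbasis_card_sum (I : finType) (e : I -> L) p :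
  hbasis e p -> #|I| = (m + n)%N.
Proof.
move=> he; have [<- <-] := hbasis_card he dimL.
rewrite -(cardC [pred i | p i == false]); congr (_ + _)%N.
by apply: eq_card => i; rewrite !inE; case: (p i).
Qed.

Lemma multiplier_dim_abelian : (forall x y : L, br x y = 0) ->
  multiplier_dim L = ('C(m + n, 2) + n)%N.
Proof.
move=> ab; have [P hd] := multiplier_dimP.
have [e he] := superdim_hbasis dimL.
have [cm cn] := hbasis_card he dimL; have cI := hbasis_card_sum he.
apply/eqP; rewrite eqn_leq; apply/andP; split.
  have il : indep [set 0] (fun _ : 'I_0 => 0 : L) by move=> c _ [].
  (* [multiplier_le_pairs] wants an index [z] even when nothing is removed; the zero superalgebra,
     which has none, goes through [multiplier_le]. *)
  case: (pickP (fun _ : 'I_m + 'I_n => true)) => [z _|I0].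
    have := multiplier_le_pairs he (z := z) (Q := finset.set0) _ _ il _ hd.
    rewrite cards0 !addn0 card_ord addn0 cI cn; apply; last by case.
      by rewrite inE.
    by move=> th ht hh q; rewrite inE.
  have := multiplier_le (a := fun _ : 'I_0 => 0 : L) (b := fun=> 0) _ il _ hd.
  rewrite card_ord addn0 leqn0 => h; rewrite (eqP (h _ _)) //; last by case.
  move=> th ht _; apply: (jacobi_closed_hbasis he ht) => i.
  by have := I0 i.
have [co [coE co_lin co_e co_part]] := hbasis_coord he.
rewrite -cI -[X in (_ + X <= _)%N]cn -card_exterior_pairs.
apply: (multiplier_ge_pairs co_e hd) => // i j _.
split=> //; have co0 k x y : co k (br x y) = 0.
  rewrite ab; have := co_lin k 0 0 0; rewrite scaler0 addr0 => ->.
  by rewrite scale0r add0r; move: (co_lin k 1 0 0); rewrite !scale1r addr0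
    => /eqP; rewrite -subr_eq0 opprD addrA subrr sub0r oppr_eq0 => /eqP.
by apply: (pair_form_cocycle0 co_lin co_part).
Qed.

(** The line [L, L] costs 1, and the pairs {q, z}, with q a central basis vector other than z, cost
    k + l; as N = 3 + k + l, this makes N - 2 in all. *)
Lemma multiplier_dim_heis k l (e : ((bool + unit) + 'I_k) + 'I_l -> L) :
  heis_basis e ->
  [/\ m = (3 + k)%N, n = l & (multiplier_dim L + (m + n) = 'C(m + n, 2) + n + 2)%N].
Proof.
move=> [he bre]; have [P hd] := multiplier_dimP.
have [cm cn] := hbasis_card he dimL; have cI := hbasis_card_sum he.
have [em en] : m = (3 + k)%N /\ n = l.
  rewrite -cm -cn !card_famcat !card_const /= !mul0n !mul1n addn0 add0n.
  by rewrite !card_sum !card_ord card_bool card_unit.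
split=> //.
pose p := @famparity (bool + unit + 'I_k) 'I_l.
pose z : ((bool + unit) + 'I_k) + 'I_l := inl (inl (inr tt)).
pose x : ((bool + unit) + 'I_k) + 'I_l := inl (inl (inl true)).
pose y : ((bool + unit) + 'I_k) + 'I_l := inl (inl (inl false)).
have zE : e z = br (e x) (e y) by rewrite bre /= subr0 scale1r.
pose Q := [set i : ((bool + unit) + 'I_k) + 'I_l |
  famcat (famcat xpred0 xpredT) xpredT i == true]%SET.
have cQ : #|Q| = (k + l)%N.
  by rewrite cardsE !card_famcat !card_const !card_ord /= mul0n !mul1n.
have Qbr q : q \in Q -> br (e q) (e x) = 0 /\ br (e q) (e y) = 0.
  by rewrite !bre; case: q => [[q|q]|q]; rewrite inE //= !scale0r.
have up : (multiplier_dim L + 1 + (k + l) <= 'C(m + n, 2) + n)%N.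
  have := multiplier_le_pairs he (z := z) (Q := Q) (J := unit)
    (l := fun=> e z) _ _ _ _ hd.
  rewrite card_unit cQ cI cn; apply.
  - by rewrite inE.
  - move=> th ht _ q /Qbr[qx qy].
    rewrite zE; apply: (th_jacobi ht (hbasis_part he q) (hbasis_part he x)).
      by rewrite qx; apply: subspace0 (th_subspacel ht _).
    by rewrite qy; apply: subspace0 (th_subspacer ht _).
  - have zI : injective (fun _ : unit => z) by case=> -[].
    exact: indep_inj zI (hbasis_indep he).
  by move=> _; rewrite zE; apply: derived_br.
suff low : ('C(m + n, 2) + n - (k + l) - 1 <= multiplier_dim L)%N.
  have := bin2 (m + n); rewrite em en in up low *; lia.
have [co [coE co_lin co_e co_part]] := hbasis_coord he.
have lin0 i : co i 0 = 0.
  have := co_lin i (-1) 0 0; rewrite scaler0 addr0 => ->.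
  by rewrite scaleN1r addNr.
(* The bracket is z times the determinant of the (x, y)-coordinates. *)
pose h u v := co x u * co y v - co y u * co x v.
have brE u v : br u v = h u v *: e z.
  have sT w : subspace [set u | br u w = h u w *: e z].
    split=> [|a u1 u2 h1 h2]; rewrite /mkset /h.
      by rewrite br0l !lin0 !mul0r subrr scale0r.
    rewrite brDl brZl (h1 : br u1 w = _) (h2 : br u2 w = _) /h !co_lin.
    by rewrite scalerA -scalerDl -![a *: _]/(a * _); congr (_ *: _); ring.
  have sT' w : subspace [set v | br w v = h w v *: e z].
    split=> [|a u1 u2 h1 h2]; rewrite /mkset /h.
      by rewrite br0r !lin0 !mulr0 subrr scale0r.
    rewrite brDr brZr (h1 : br w u1 = _) (h2 : br w u2 = _) /h !co_lin.
    by rewrite scalerA -scalerDl -![a *: _]/(a * _); congr (_ *: _); ring.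
  apply: (hbasis_ext he (sT v) _ u) => i; apply: (hbasis_ext he (sT' _) _ v) => j.
  rewrite /mkset bre /h !co_e; congr (_ *: _).
  by case: i => [[[[]|[]]|i]|i]; case: j => [[[[]|[]]|j]|j];
    rewrite ?(eqE, eqxx) /= ?(mulr0, mul0r, mulr1, subr0, sub0r, subrr, oppr0).
have co_br i u v : co i (br u v) = h u v * (i == z)%:R.
  rewrite brE -[_ *: _]addr0 co_lin lin0 addr0 co_e //.
have co_br0 i u v : i != z -> co i (br u v) = 0.
  by move=> /negPf iz; rewrite co_br iz mulr0.
pose G b : ((bool + unit) + 'I_k) + 'I_l := inl (inl (inl b)).
(* A third exterior power of the plane spanned by x* and y* vanishes; this closes the forms of the
   pairs {x, z} and {y, z}. For two odd arguments both sides are 0. *)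
have jac b i j u v w : part i u -> part j v ->
    co (G b) u * h v w =
    (-1) ^+ (i && j) * (co (G b) v * h u w) - h u v * co (G b) w.
  move=> pu pv; rewrite /h -/(G true) -/(G false) -[x]/(G true) -[y]/(G false).
  case: i j pu pv => -[] pu pv; rewrite /= ?expr1 ?expr0.
  + rewrite !(fun b => co_part (G b) true u pu) // !(fun b => co_part (G b) true v pv) //.
    by ring.
  + by case: b; ring.
  + by case: b; ring.
  by case: b; ring.
have Gz b : G b == z = false by [].
have cocGz b : cocycle (p (G b) (+) p z) (pair_form p co (G b) z).
  apply: (pair_form_cocycle co_lin co_part) => i j u v w pu pv.
  rewrite /pair_form !co_br eqxx Gz /= !mulr1 !mulr0 (jac b _ _ _ _ _ pu pv).
  by rewrite expr0; ring.
have coczG b : cocycle (p z (+) p (G b)) (pair_form p co z (G b)).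
  apply: (pair_form_cocycle co_lin co_part) => i j u v w pu pv.
  rewrite /pair_form !co_br eqxx Gz /= !mulr1 !mulr0 (jac b _ _ _ _ _ pu pv).
  by rewrite expr0; ring.
(* Besides the redundant pairs, {x, y} is left out: its bracket is z, so it gives no element of
   R. *)
pose U := (pairs_with z Q :|: [set [set x; y]%SET])%SET.
have cS : ('C(m + n, 2) + n - (k + l) - 1 <= #|exterior_pairs p :\: U|)%N.
  rewrite cardsD card_exterior_pairs cI cn -subnDA leq_sub2l //.
  rewrite -cQ -(card_pairs_with z Q) -(cards1 [set x; y]%SET).
  by apply: leq_trans (leq_card_setU _ _); apply: subset_leq_card;
    apply: finset.subsetIr.
apply: leq_trans cS _; apply: (multiplier_ge_pairs co_e hd) => [|i j].
  exact: finset.subsetDl.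
rewrite finset.in_setD finset.in_setU finset.in_set1 negb_or.
move=> /andP[/andP[nQ nxy] ij]; rewrite pairs_withE in nQ.
rewrite exterior_pairsE in ij.
have [iz|iz] := eqVneq i z.
  subst i; case: j nQ nxy ij => [[[b|[]]|j]|j] //.
  - by move=> _ _ _; rewrite bre scale0r; split=> //; apply: coczG.
  - by rewrite !eqxx andbT orbC inE.
  by rewrite !eqxx andbT orbC inE.
have [jz|jz] := eqVneq j z.
  subst j; case: i nQ nxy ij {iz} => [[[b|[]]|i]|i] //.
  - by move=> _ _ _; rewrite bre scale0r; split=> //; apply: cocGz.
  - by rewrite !eqxx andbT inE.
  by rewrite !eqxx andbT inE.
(* Neither index is [z], so both coordinates vanish on [L, L]. *)
split; last first.
  by apply: (pair_form_cocycle0 co_lin co_part) => u v; apply: co_br0.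
rewrite bre; case: i nxy {nQ ij iz jz} => [[[a|i]|i]|i] /=; rewrite ?scale0r //.
case: j => [[[b|j]|j]|j] /=; rewrite ?scale0r //.
case: a b => -[]; rewrite ?subrr ?scale0r ?eqxx //.
by rewrite finset.setUC eqxx.
Qed.

End MultiplierDim.

Section Invariant.
Variables (K : numFieldType) (L : lieSuperalgebra K) (m n : nat).

(** (N - 1)(N - 2)/2 = binom(N, 2) - N + 1; moving the negative terms across avoids truncated
    subtraction. *)
Lemma s_invariant_eq0 : (s_invariant L m n = 0) <->
  ('C(m + n, 2) + n + 2 = multiplier_dim L + (m + n))%N.
Proof.
rewrite /s_invariant; set d := multiplier_dim L.
have c2 : ('C(m + n, 2)%:R = (m%:R + n%:R) * (m%:R + n%:R - 1) / 2 :> rat).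
  have := congr1 (fun k => k%:R : rat) (mul_bin_diag (m + n) 1).
  rewrite bin1 !natrM natrD; case: (m + n)%N (natrD rat m n) => [|N] e.
    by rewrite bin0n /= -e !mul0r.
  rewrite -e -natr1 addrK => h; apply: (mulfI (x := 2)) => //.
  by rewrite -h mulrCA divff // mulr1.
have -> : (m%:R + n%:R - 2) * (m%:R + n%:R - 1) / 2 + n%:R + 1 - d%:R =
  ('C(m + n, 2) + n + 2)%:R - (d + (m + n))%:R :> rat.
  by rewrite !natrD c2; field.
split=> [/eqP|->]; last by rewrite subrr.
by rewrite subr_eq0 eqr_nat => /eqP.
Qed.

End Invariant.

Section Classification.
Variables (K : numFieldType) (L : lieSuperalgebra K) (m n : nat).
Hypothesis dimL : superdim L m n.

Lemma isomorphic_abelian : (forall x y : L, br x y = 0) ->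
  isomorphic L (abelian K m n).
Proof.
move=> ab; have [e he] := superdim_hbasis dimL.
apply: (hbasis_isomorphic (c := fun _ _ _ => 0) he (abelian_fam_hbasis K m n)).
  by move=> i j; rewrite ab big1 // => k _; rewrite scale0r.
by move=> i j; rewrite big1 // => k _; rewrite scale0r.
Qed.

Lemma abelian_isomorphic k l : isomorphic L (abelian K k l) ->
  [/\ forall x y : L, br x y = 0, m = k & n = l].
Proof.
move=> iso; have [f [_ fbr] he] := isomorphic_hbasis iso (abelian_fam_hbasis K k l).
have [<- <-] := hbasis_card he dimL.
rewrite !card_famcat !card_const !card_ord !mul0n !mul1n addn0; split=> // x y.
have s y' : subspace [set x : L | br x y' = 0].
  split=> [|a u v hu hv]; first exact: br0l.
  by rewrite /mkset brDl brZl (hu : br u y' = 0) (hv : br v y' = 0) scaler0 addr0.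
have s' x' : subspace [set y : L | br x' y = 0].
  split=> [|a u v hu hv]; first exact: br0r.
  by rewrite /mkset brDr brZr (hu : br x' u = 0) (hv : br x' v = 0) scaler0 addr0.
apply: (hbasis_ext he (s y) _ x) => i; apply: (hbasis_ext he (s' _) _ y) => j.
by rewrite /mkset /= -fbr (_ : br _ _ = 0) // linear0.
Qed.

Lemma heis_basis_isomorphic k l (M : lieSuperalgebra K)
    (e : ((bool + unit) + 'I_k) + 'I_l -> L)
    (e' : ((bool + unit) + 'I_k) + 'I_l -> M) :
  heis_basis e -> heis_basis e' -> isomorphic L M.
Proof.
move=> [he bre] [he' bre'].
apply: (hbasis_isomorphic he he' (c := fun i j k0 =>
  heis_const K i j * (k0 == inl (inl (inr tt)))%:R)) => i j.
  rewrite bre (bigD1 (inl (inl (inr tt)))) //= ?eqxx mulr1 big1 ?addr0 // => a.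
  by move=> /= /negPf ->; rewrite mulr0 scale0r.
rewrite bre' (bigD1 (inl (inl (inr tt)))) //= ?eqxx mulr1 big1 ?addr0 // => a.
by move=> /= /negPf ->; rewrite mulr0 scale0r.
Qed.

Lemma isomorphic_heis_basis k l :
  isomorphic L (dsum (heisenberg K 1 0) (abelian K k l)) ->
  exists e : ((bool + unit) + 'I_k) + 'I_l -> L, heis_basis e.
Proof.
have [hM brM] := heis_fam_basis K k l.
move=> iso; have [f [_ fbr] he] := isomorphic_hbasis iso hM.
exists (f \o @heis_fam K k l); split=> // i j.
by rewrite /= -fbr brM linearZ.
Qed.

End Classification.

Lemma classification (K : numFieldType) (L : lieSuperalgebra K) (m n : nat)
    (dimL : superdim L m n) (nilL : nilpotent L) :
  s_invariant L m n = 0 <->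
  [\/ (3 <= m)%N /\
        isomorphic L (dsum (heisenberg K 1 0) (abelian K (m - 3) n)),
      isomorphic L (abelian K 2 0),
      isomorphic L (abelian K 0 2)
    | isomorphic L (abelian K 1 1)].
Proof.
rewrite s_invariant_eq0; split; last first.
  have ab k l : (k + l = 2)%N -> isomorphic L (abelian K k l) ->
      ('C(m + n, 2) + n + 2 = multiplier_dim L + (m + n))%N.
    move=> kl /(abelian_isomorphic dimL)[br0 em en].
    by rewrite (multiplier_dim_abelian dimL br0) em en kl.
  case=> [[m3 /isomorphic_heis_basis[e he]]|||]; try exact: ab.
  by have [_ _ ->] := multiplier_dim_heis dimL he.
have [ab|nab] := pselect (forall x y : L, br x y = 0).
  rewrite (multiplier_dim_abelian dimL ab) => /addnI mn2.
  have := isomorphic_abelian dimL ab.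
  have [] : [\/ m = 2 /\ n = 0, m = 0 /\ n = 2 | m = 1 /\ n = 1]%N.
    clear -mn2; case: m n mn2 => [|[|[|m']]] [|[|[|n']]] // _;
      by [apply: Or32|apply: Or33|apply: Or31].
  - by case=> -> -> iso; apply: Or42.
  - by case=> -> -> iso; apply: Or43.
  by case=> -> -> iso; apply: Or44.
have [x [y xy0]] : exists x y : L, br x y != 0.
  apply: contrapT => h; apply: nab => x y; apply/eqP/negPn/negP => xy0.
  by apply: h; exists x, y.
have [P hd] := multiplier_dimP dimL.
have [le|[k [l [e he]]]] := multiplier_dichotomy dimL nilL xy0.
  (* The bound is one below the value that s(L) = 0 requires. *)
  by move=> eq; have := le P _ hd; lia.
move=> _; have [em en _] := multiplier_dim_heis dimL he.
apply: Or41; rewrite em en addKn; split; first exact: leq_addr.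
exact: heis_basis_isomorphic he (heis_fam_basis K k l).
Qed.

Local Open Scope complex_scope.

Theorem theorem1p1 (R : realType) (L : lieSuperalgebra R[i]) (m n : nat)
    (dimL : superdim L m n) (nilL : nilpotent L) :
  s_invariant L m n = 0 <->
  [\/ (3 <= m)%N /\
        isomorphic L (dsum (heisenberg R[i] 1 0) (abelian R[i] (m - 3) n)),
      isomorphic L (abelian R[i] 2 0),
      isomorphic L (abelian R[i] 0 2)
    | isomorphic L (abelian R[i] 1 1)].
Proof. exact: classification. Qed.
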